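(* Let $p$ be a Lebesgue probability density on $\mathbb{R}^k$ such that $\nabla\log p$ is $L$-Lipschitz continuous for some $L>0$. Then all of the following hold. (a) $\nabla\log p$ is differentiable Lebesgue-almost everywhere, and $\|\nabla^2\log p\|\le L$ where it exists. (b) The tails of $p$ are at least as heavy as those of a Gaussian distribution; in fact $p$ is bounded below by a tangent Gaussian curve with variance-covariance matrix $\frac1LI$ at each point: for each $x_0\in\mathbb{R}^k$ there are $C>0$ and $m\in\mathbb{R}^k$ such that $g(x)=C\exp(-\frac L2\|x-m\|^2)$ satisfies $g(x_0)=p(x_0)$, $\nabla g(x_0)=\nabla p(x_0)$ and $p(x)\ge g(x)$ for all $x\in\mathbb{R}^k$. This further implies that $\mathrm{supp}(p)=\mathbb{R}^k$. (c) $p$ is uniformly bounded above. (d) $p$ is Lipschitz. (e) For any $f:\mathbb{R}^k\to\mathbb{R}$ which is locally Lipschitz, with $\nabla f(x)$ and $f(x)\nabla\log p(x)$ integrable with respect to $p(x)\,dx$, $$\mathbb{E}_{X\sim p}\big[f(X)\nabla\log p(X)\big]=-\mathbb{E}_{X\sim p}\big[\nabla f(X)\big].$$ Similarly, for locally Lipschitz $f:\mathbb{R}^k\to\mathbb{R}^m$ whose components satisfy the same integrability conditions, $\mathbb{E}_{X\sim p}[f(X)\nabla\log p(X)']=-\mathbb{E}_{X\sim p}[Jf(X)]$, where $Jf$ is the Jacobian matrix, and, when $m=k$, $\mathbb{E}_{X\sim p}[\nabla\log p(X)'f(X)]=-\mathbb{E}_{X\sim p}[\mathrm{div}(f)(X)]$.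 (f) $\mathbb{E}_{X\sim p}[\nabla\log p(X)]=0$ and $\mathrm{Var}_{X\sim p}[\nabla\log p(X)]=-\mathbb{E}_{X\sim p}[\nabla^2\log p(X)]$. (g) If $X\sim p$ then $\nabla\log p(X)$ is sub-Gaussian with proxy-variance $L$, i.e. $\mathbb{E}_{X\sim p}\exp(\langle t,\nabla\log p(X)\rangle)\le\exp(L\|t\|^2/2)$ for all $t\in\mathbb{R}^k$. Hence all polynomial moments of $\nabla\log p(X)$ and $\nabla^2\log p(X)$ are finite.
   Context: The assumption that $\nabla\log p$ is Lipschitz is understood to include that $\log p$ is finite and differentiable on $\mathbb{R}^k$. $\|\cdot\|$ is the Euclidean norm on vectors and the operator norm on matrices; primes denote transposes. *)

(* Defs.v *)
From HB Require Import structures.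
From mathcomp Require Import all_boot all_order all_algebra.
From mathcomp Require Import all_classical all_reals all_analysis.
From mathcomp Require Import measurable_realfun.

Set Implicit Arguments.
Unset Strict Implicit.
Unset Printing Implicit Defensive.
Import Order.TTheory GRing.Theory Num.Theory.
Import numFieldNormedType.Exports.

Local Open Scope classical_set_scope.
Local Open Scope ring_scope.

(* 'rV[T]_n carries the sigma-algebra generated by the coordinates, as
   n.-tuple T does; for T = R it is the Borel sigma-algebra of R^n. *)
Definition measure_rV_display : measure_display -> measure_display.
Proof. exact. Qed.

Section measurable_rV.
Context {d} {T : measurableType d}.
Variable n : nat.

Definition rV_coord (i : 'I_n) (x : 'rV[T]_n) : T := x ord0 i.

Let rV_set0 : g_sigma_preimage rV_coord set0.
Proof. exact: sigma_algebra0. Qed.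

Let rV_setC A : g_sigma_preimage rV_coord A -> g_sigma_preimage rV_coord (~` A).
Proof. exact: sigma_algebraC. Qed.

Let rV_bigcup (F : _^nat) : (forall i, g_sigma_preimage rV_coord (F i)) ->
  g_sigma_preimage rV_coord (\bigcup_i (F i)).
Proof. exact: sigma_algebra_bigcup. Qed.

HB.instance Definition _ := @isMeasurable.Build (measure_rV_display d)
  'rV[T]_n (g_sigma_preimage rV_coord) rV_set0 rV_setC rV_bigcup.

Lemma measurable_coord (i : 'I_n) :
  measurable_fun [set: 'rV[T]_n] (fun x => x ord0 i).
Proof.
move=> _ Y mY; rewrite setTI; apply: sub_sigma_algebra => /=.
rewrite -bigcup_seq/=; exists i => /=; first by rewrite mem_index_enum.
by exists Y => //; rewrite setTI.
Qed.

End measurable_rV.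

Lemma measurable_fun_rVP d1 d2 (T1 : measurableType d1) (T2 : measurableType d2)
    n (f : T1 -> 'rV[T2]_n) :
  measurable_fun [set: T1] f <->
  forall i, measurable_fun [set: T1] (fun x => f x ord0 i).
Proof.
split=> [mf i|mf].
  exact: (measurableT_comp (measurable_coord i) mf).
suff mfg : g_sigma_preimage (fun i => rV_coord i \o f) `<=` measurable.
  move=> _ A mA; apply: mfg.
  by rewrite g_sigma_preimage_comp; exists A.
apply: smallest_sub; first exact: sigma_algebra_measurable.
rewrite -bigcup_seq => A [i _ [B mB <-]].
exact: mf.
Qed.

Section lebesgue_rV.
Context {R : realType}.

Definition cons_rV n (tv : measurableTypeR R * 'rV[R]_n) : 'rV[R]_n.+1 :=
  row_mx (const_mx tv.1 : 'rV_1) tv.2.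

Definition uncons_rV n (x : 'rV[R]_n.+1) : measurableTypeR R * 'rV[R]_n :=
  (x ord0 ord0, rsubmx (x : 'rV_(1 + n))).

Lemma cons_rV0 n (tv : measurableTypeR R * 'rV[R]_n) :
  cons_rV tv ord0 ord0 = tv.1.
Proof.
transitivity ((const_mx tv.1 : 'rV[R]_1) ord0 ord0); last by rewrite mxE.
rewrite -(@row_mxEl R 1 1 n (const_mx tv.1) tv.2 ord0 ord0).
by congr (row_mx _ _ _ _); exact: val_inj.
Qed.

Lemma cons_rVS n (tv : measurableTypeR R * 'rV[R]_n) (i : 'I_n) :
  cons_rV tv ord0 (lift ord0 i) = tv.2 ord0 i.
Proof.
rewrite -(@row_mxEr R 1 1 n (const_mx tv.1) tv.2 ord0 i).
by congr (row_mx _ _ _ _); exact: val_inj.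
Qed.

Lemma cons_rVK n : cancel (@cons_rV n) (@uncons_rV n).
Proof.
by move=> [t v]; rewrite /uncons_rV cons_rV0 /cons_rV row_mxKr.
Qed.

Lemma measurable_cons_rV n : measurable_fun setT (@cons_rV n).
Proof.
apply/measurable_fun_rVP => i.
have [j ->|->] := unliftP ord0 i.
  rewrite (_ : (fun _ => _) = (fun v : 'rV[R]_n => v ord0 j) \o snd).
    exact: (measurableT_comp (measurable_coord j) measurable_snd).
  by apply/funext => tv; exact: cons_rVS.
rewrite (_ : (fun _ => _) = (fst : _ -> R)); first exact: measurable_fst.
by apply/funext => tv; exact: cons_rV0.
Qed.

Lemma measurable_uncons_rV n : measurable_fun setT (@uncons_rV n).
Proof.
apply/measurable_fun_pair => /=.
  exact: measurable_coord.
apply/measurable_fun_rVP => i.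
rewrite (_ : (fun _ => _) = fun x : 'rV[R]_n.+1 => x ord0 (rshift 1 i)).
  exact: measurable_coord.
by apply/funext => x; rewrite /= mxE.
Qed.

Section lebesgue_rV_step.
Variables (n : nat) (mu : {sigma_finite_measure set 'rV[R]_n -> \bar R}).

Definition lebesgue_rV_step : set 'rV[R]_n.+1 -> \bar R :=
  pushforward (@lebesgue_measure R \x mu)%E (@cons_rV n).

Let step0 : lebesgue_rV_step set0 = 0%E.
Proof. by rewrite /lebesgue_rV_step /pushforward preimage_set0 measure0. Qed.

Let step_ge0 A : (0 <= lebesgue_rV_step A)%E.
Proof. by rewrite /lebesgue_rV_step /pushforward measure_ge0. Qed.

Let step_sigma_additive : semi_sigma_additive lebesgue_rV_step.
Proof.
move=> F mF tF mUF; rewrite /lebesgue_rV_step /pushforward preimage_bigcup.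
apply: measure_semi_sigma_additive.
- by move=> i; rewrite -[X in measurable X]setTI; exact: measurable_cons_rV.
- apply/trivIsetP => /= i j _ _ ij; rewrite -preimage_setI.
  by move/trivIsetP : tF => /(_ _ _ _ _ ij) ->//; rewrite preimage_set0.
- rewrite -preimage_bigcup -[X in measurable X]setTI.
  exact: measurable_cons_rV.
Qed.

HB.instance Definition _ := isMeasure.Build _ _ _
  lebesgue_rV_step step0 step_ge0 step_sigma_additive.

Let step_sigma_finite : sigma_finite setT lebesgue_rV_step.
Proof.
have [F FT Foo] : sigma_finite setT (@lebesgue_measure R \x mu)%E.
  have /sigma_finiteP[A [TA ndA Aoo]] := sigma_finiteT (@lebesgue_measure R).
  have /sigma_finiteP[B [TB ndB Boo]] := sigma_finiteT mu.
  exists (fun i => A i `*` B i).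
    rewrite -setXTT TA TB; apply/seteqP; split=> -[x y].
      move=> [/= [i _ Aix] [j _ Bjy]]; exists (maxn i j) => //; split.
        by move: x Aix; exact/subsetPset/ndA/leq_maxl.
      by move: y Bjy; exact/subsetPset/ndB/leq_maxr.
    by move=> [i _ []/= ? ?]; split; exists i.
  move=> i; have [? ?] := Aoo i; have [? ?] := Boo i.
  split; first exact: measurableX.
  by rewrite product_measure1E// lte_mul_pinfty// ge0_fin_numE.
exists (fun i => @uncons_rV n @^-1` F i).
  by rewrite -preimage_bigcup -FT preimage_setT.
move=> i; have [mFi Fioo] := Foo i; split.
  by rewrite -[X in measurable X]setTI; exact: measurable_uncons_rV.
rewrite /lebesgue_rV_step /pushforward (_ : _ @^-1` _ = F i)//.
by apply/seteqP; split => x /=; rewrite cons_rVK.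
Qed.

HB.instance Definition _ := @Measure_isSigmaFinite.Build _ _ _
  lebesgue_rV_step step_sigma_finite.

End lebesgue_rV_step.

(* Lebesgue measure on R^n, by iterated products of lebesgue_measure; R^0 is a
   point, of mass 1. *)
Fixpoint lebesgue_rV n : {sigma_finite_measure set 'rV[R]_n -> \bar R} :=
  if n is n'.+1 then lebesgue_rV_step (lebesgue_rV n') else \d_(0 : 'rV[R]_0).

Lemma lebesgue_rV_box n (A : 'I_n -> set (measurableTypeR R)) :
  (forall i, measurable (A i)) ->
  lebesgue_rV n [set x | forall i, A i (x ord0 i)] =
  (\prod_(i < n) lebesgue_measure (A i))%E.
Proof.
elim: n A => [|n IHn] A mA.
  by rewrite big_ord0 /= diracE mem_set// => -[].
rewrite big_ord_recl -(IHn (fun i => A (lift ord0 i)))//.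
pose B := [set x : 'rV[R]_n | forall i, A (lift ord0 i) (x ord0 i)].
have mB : measurable B.
  rewrite (_ : B = \bigcap_(i in [set: 'I_n])
      ((fun x : 'rV[R]_n => x ord0 i) @^-1` A (lift ord0 i))).
    apply: fin_bigcap_measurable => // i _; rewrite -[X in measurable X]setTI.
    exact: (measurable_coord i measurableT (mA (lift ord0 i))).
  by apply/seteqP; split => [x Ax i _|x Ax i]; exact: Ax.
rewrite -/B -product_measure1E//= /lebesgue_rV_step /pushforward.
congr ((_ \x _)%E _); apply/seteqP; split => -[t v] /=.
  move=> Atv; split=> [|i].
    by have := Atv ord0; rewrite cons_rV0.
  by have := Atv (lift ord0 i); rewrite cons_rVS.
move=> [At Av] i; have [j ->|->] := unliftP ord0 i.
  by rewrite cons_rVS; exact: Av.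
by rewrite cons_rV0.
Qed.

End lebesgue_rV.

Section density.
Context {d} {T : measurableType d} {R : realType}.
Variable mu : {measure set T -> \bar R}.

Definition prob_density (p : T -> R) :=
  [/\ measurable_fun setT p, forall x, 0 <= p x
    & (\int[mu]_x (p x)%:E = 1)%E].

Variables (p : T -> R) (dp : prob_density p).

Definition density_prob of prob_density p : set T -> \bar R :=
  fun A => (\int[mu]_(x in A) (p x)%:E)%E.

Let density0 : density_prob dp set0 = 0%E.
Proof. by rewrite /density_prob integral_set0. Qed.

Let density_ge0 A : (0 <= density_prob dp A)%E.
Proof.
have [_ p0 _] := dp.
by rewrite /density_prob integral_ge0// => x _; rewrite lee_fin.
Qed.

Let density_sigma_additive : semi_sigma_additive (density_prob dp).
Proof.
have [mp p0 _] := dp.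
move=> F mF tF mUF; rewrite /density_prob ge0_integral_bigcup//=; last 2 first.
- by apply/measurable_EFinP; exact: measurable_funTS.
- by move=> x _; rewrite lee_fin.
apply: is_cvg_ereal_nneg_natsum_cond => n _ _.
by rewrite integral_ge0// => x _; rewrite lee_fin.
Qed.

HB.instance Definition _ := isMeasure.Build _ _ _
  (density_prob dp) density0 density_ge0 density_sigma_additive.

Let density_setT : density_prob dp setT = 1%E.
Proof. by have [_ _] := dp. Qed.

HB.instance Definition _ := @Measure_isProbability.Build _ _ R
  (density_prob dp) density_setT.

End density.

Section euclidean.
Context {R : realType}.

Definition dotv n (u v : 'rV[R]_n) : R := \sum_(i < n) u ord0 i * v ord0 i.

(* The library norm `|v| on 'rV_n is the sup norm; it induces the same topology
   but not the same Lipschitz constants as the Euclidean norm. *)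
Definition enorm n (v : 'rV[R]_n) : R := Num.sqrt (dotv v v).

(* Operator norm of A acting on column vectors: v *m A^T is the row (A v^T)^T. *)
Definition opnorm m n (A : 'M[R]_(m, n)) : R :=
  sup [set enorm (v *m A^T) | v in [set v : 'rV[R]_n | enorm v <= 1]].

Definition grad n (f : 'rV[R]_n -> R) (x : 'rV[R]_n) : 'rV[R]_n :=
  \row_j 'D_(delta_mx ord0 j) f x.

Lemma diff_grad n (f : 'rV[R]_n -> R) (x v : 'rV[R]_n) :
  differentiable f x -> 'd f x v = dotv (grad f x) v.
Proof.
move=> df; rewrite [in LHS](row_sum_delta v) linear_sum /dotv.
by apply: eq_bigr => j _; rewrite linearZ /= mxE deriveE// mulrC.
Qed.

(* Row i is the gradient of the i-th component; this is the transpose of the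
   library's 'J f x, which acts on row vectors. *)
Definition jac n m (f : 'rV[R]_n -> 'rV[R]_m) (x : 'rV[R]_n) : 'M[R]_(m, n) :=
  \matrix_(i, j) grad (fun y => f y ord0 i) x ord0 j.

Lemma jacE n m (f : 'rV[R]_n -> 'rV[R]_m) (x : 'rV[R]_n) :
  differentiable f x -> jac f x = ('J f x)^T.
Proof.
move=> df; apply/matrixP => i j; rewrite !mxE.
have dfj : derivable f x (delta_mx ord0 j) by exact: diff_derivable.
have := congr1 (fun v : 'rV[R]_m => v ord0 i)
  (deriveEjacobian (delta_mx ord0 j) df).
by rewrite derive_mx// mxE => ->; rewrite -rowE !mxE.
Qed.

Definition hess n (f : 'rV[R]_n -> R) : 'rV[R]_n -> 'M[R]_n := jac (grad f).

Definition divergence n (f : 'rV[R]_n -> 'rV[R]_n) (x : 'rV[R]_n) : R :=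
  \tr (jac f x).

Definition locally_lipschitz (V W : normedModType R) (f : V -> W) : Prop :=
  [locally [lipschitz f x | x in setT]].

Section random_matrix.
Context {d} {T : measurableType d}.
Variable P : probability T R.

Definition mx_integrable m n (F : T -> 'M[R]_(m, n)) : Prop :=
  forall i j, P.-integrable setT (fun x => (F x i j)%:E).

(* Every monomial in the entries of F, hence every polynomial in them, is
   integrable. *)
Definition polynomial_moments_finite m n (F : T -> 'M[R]_(m, n)) : Prop :=
  forall a : 'I_m -> 'I_n -> nat,
    P.-integrable setT (fun x => (\prod_i \prod_j F x i j ^+ a i j)%:E).

End random_matrix.

End euclidean.

(* Main.v *)
(* Write s = grad log p.  The Lipschitz bound gives, for all x and u,
     log p (x + u) >= log p x + <s x, u> - L |u|^2 / 2.
   Completing the square turns this into the tangent Gaussian, with mean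
   x + s x / L.  Integrating it over the unit box around its mean gives
   p x * exp (|s x|^2 / (2 L)) <= exp (L k / 8), which bounds both p and
   |grad p| = p |s|.  Integrating the exponentiated bound over x for a fixed u
   gives the sub-Gaussian estimate, by translation invariance.
   Rademacher's theorem starts on the line: if f is 1/2-Lipschitz, then
   f + x / 2 and x / 2 - f have Lebesgue-Stieltjes measures adding up to
   Lebesgue measure, so f is an indefinite integral by Radon-Nikodym.  Tonelli
   and translation invariance carry this over to directional derivatives, whose
   a.e. linearity in the direction is checked against test functions.
   Stein's identity comes from the vanishing integral of any directional
   derivative of a compactly supported locally Lipschitz function (translation
   invariance of difference quotients), applied to a cutoff of f p. *)
Require Import Defs.
From HB Require Import structures.
From mathcomp Require Import all_boot all_order all_algebra.
From mathcomp Require Import all_classical all_reals all_analysis.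
From mathcomp Require Import measurable_realfun.
From mathcomp Require Import ring lra.

Set Implicit Arguments.
Unset Strict Implicit.
Unset Printing Implicit Defensive.
Import Order.TTheory GRing.Theory Num.Theory.
Import numFieldNormedType.Exports.

Local Open Scope classical_set_scope.
Local Open Scope ring_scope.

(** Two norms run side by side. The topology, differentiability and auxiliary Lipschitz bounds refer
    to the sup norm of row vectors, the constant [L] to the Euclidean norm; passing from one to the
    other costs a factor sqrt k. Total differentiability of the score enters part (a) alone.
    Whatever is integrated involves only directional derivatives ['D_v]. Where such a derivative
    exists it is the limit of quotients with step 1/(m+1); elsewhere it takes the default value 0.
    For Lipschitz functions it is therefore bounded and measurable on the whole space, and the
    Hessian can be integrated without removing a null set. Tonelli can only be applied once the set
    where a directional derivative exists is known to be measurable. Its definition quantifies over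
    uncountably many step sizes, hence the detour through rational ones. The exponent L k / 8 is L /
    2 times k / 4, the largest squared Euclidean distance from the centre of the unit box to one of
    its points. *)

Lemma ae_imp d (T : measurableType d) (R : realFieldType)
    (mu : {measure set T -> \bar R}) (P Q : T -> Prop) :
  {ae mu, forall x, P x} -> (forall x, P x -> Q x) -> {ae mu, forall x, Q x}.
Proof. by move=> aeP PQ; apply: filterS aeP. Qed.

Lemma ae_and d (T : measurableType d) (R : realFieldType)
    (mu : {measure set T -> \bar R}) (P Q : T -> Prop) :
  {ae mu, forall x, P x} -> {ae mu, forall x, Q x} ->
  {ae mu, forall x, P x /\ Q x}.
Proof. by move=> aeP aeQ; apply: filterI. Qed.

(** * Lipschitz functions on the real line *)

Lemma lebesgue_stieltjes_measure_oc (R : realType) (g : cumulative R R) (a b : R) :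
  a <= b -> lebesgue_stieltjes_measure g `]a, b]%classic = (g b - g a)%:E.
Proof.
move=> ab; rewrite /lebesgue_stieltjes_measure /measure_extension.
by rewrite measurable_mu_extE/= ?wlength_itv_bnd//; exact: is_ocitv.
Qed.

Section lipschitz_derivable_half.
Context {R : realType}.
Variable f : R -> R.
Hypothesis f_lip : forall x y, `|f x - f y| <= 2^-1 * `|x - y|.

Let continuous_lip c (g : R -> R) : 0 < c ->
  (forall x y, `|g x - g y| <= c * `|x - y|) -> continuous g.
Proof.
move=> c0 gl x; apply/cvgrPdist_le => e e0.
near=> y; rewrite (le_trans (gl _ _))//.
rewrite -ler_pdivlMl//; near: y.
by apply: cvgr_dist_le => //; rewrite mulr_gt0// invr_gt0.
Unshelve. all: by end_near. Qed.

Let g x := f x + 2^-1 * x.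
Let h x := x - g x.

Let g_nd : {homo g : x y / x <= y}.
Proof.
move=> x y xy; rewrite /g -subr_ge0; have := f_lip y x.
rewrite (ger0_norm (_ : 0 <= y - x)) ?subr_ge0//.
by move=> /ler_normlP[]; lra.
Qed.

Let h_nd : {homo h : x y / x <= y}.
Proof.
move=> x y xy; rewrite /h /g -subr_ge0; have := f_lip y x.
rewrite (ger0_norm (_ : 0 <= y - x)) ?subr_ge0//.
by move=> /ler_normlP[]; lra.
Qed.

Let f_continuous : continuous f.
Proof. by apply: continuous_lip f_lip; rewrite invr_gt0. Qed.

Let g_continuous : continuous g.
Proof.
move=> x; apply: cvgD; first exact: f_continuous.
by apply: cvgM; [exact: cvg_cst|exact: cvg_id].
Qed.

Let h_continuous : continuous h.
Proof. by move=> x; apply: cvgB; [exact: cvg_id|exact: g_continuous]. Qed.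

HB.instance Definition _ := isCumulative.Build R _ R g g_nd
  (right_continuousW g_continuous).
HB.instance Definition _ := isCumulative.Build R _ R h h_nd
  (right_continuousW h_continuous).

Let mug : {measure set (measurableTypeR R) -> \bar R} :=
  @lebesgue_stieltjes_measure R g.

Let mug_le A : measurable A -> (mug A <= @lebesgue_measure R A)%E.
Proof.
move=> mA.
have -> : @lebesgue_measure R A = measure_add
    (lebesgue_stieltjes_measure g) (lebesgue_stieltjes_measure h) A.
  apply: (lebesgue_measure_unique (mu := measure_add _ _)) => //.
  move=> _ [[a b] _ <-]; rewrite [RHS]measure_addE/=.
  have [ab|ba] := leP a b; last first.
    by rewrite set_itv_ge ?bnd_simp -?leNgt ?ltW// !measure0 adde0.
  rewrite /lebesgue_measure !lebesgue_stieltjes_measure_oc//=.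
  by rewrite -EFinD; congr (_%:E); rewrite /h; ring.
by rewrite measure_addE leeDl.
Qed.

(** Radon-Nikodym is applied on a bounded interval, where the measure of [g] is finite. For y in
    ]-n, n[ its density q satisfies g y - g (-n) = integral of q up to y, so [f] is an indefinite
    integral plus an affine function. The open interval makes this identity hold near the point, as
    differentiation requires. *)
Let half_ae_derivable_on (n : nat) :
  {ae @lebesgue_measure R, forall x, `]- n%:R, n%:R[%classic x -> derivable f x 1}.
Proof.
pose D := `]- n%:R, n%:R]%classic : set (measurableTypeR R).
have mD : measurable D by exact: measurable_itv.
have nn : - n%:R <= n%:R :> R by rewrite (@le_trans _ _ 0)// oppr_le0.
have fD : (mug D < +oo)%E by rewrite /mug/= lebesgue_stieltjes_measure_oc// ltry.
pose nu : {finite_measure set (measurableTypeR R) -> \bar R} := mfrestr mD fD.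
have nu_dom : nu `<< (@lebesgue_measure R).
  apply/null_content_dominatesP => A mA A0.
  apply/eqP; rewrite eq_le measure_ge0 andbT.
  rewrite [leLHS](_ : _ = mug (A `&` D))//.
  rewrite (le_trans (mug_le _))//; first exact: measurableI.
  by rewrite -A0 le_measure// inE//; exact: measurableI.
pose q := Radon_Nikodym_SigmaFinite.f nu (@lebesgue_measure R).
have qfin x : q x \is a fin_num by exact: Radon_Nikodym_SigmaFinite.f_fin_num.
have qint : (@lebesgue_measure R).-integrable setT q.
  exact: Radon_Nikodym_SigmaFinite.f_integrable.
have qnu A : measurable A -> nu A = (\int[@lebesgue_measure R]_(x in A) q x)%E.
  exact: Radon_Nikodym_SigmaFinite.f_integral.
have qE : EFin \o (fine \o q) = q by apply/funext => x /=; rewrite fineK.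
have := @FTC1Ny R (fine \o q).
rewrite qE => FTC.
have qintS y : (@lebesgue_measure R).-integrable `]-oo, y] q.
  by apply: integrableS qint.
have ql : locally_integrable setT (fine \o q).
  by apply: open_integrable_locally; rewrite ?qE//; exact: openT.
apply: (ae_imp (FTC qintS ql)) => x [dF _]; rewrite /= in_itv/= => /andP[nx xn].
set F := (fun _ : R => _) in dF.
apply: (near_eq_derivable (f := F \+ (fun y => g (- n%:R) - 2^-1 * y))).
  near=> y => /=; rewrite /F.
  have yn : - n%:R < y < n%:R.
    apply/andP; split; near: y.
      exact: lt_nbhsr.
      exact: lt_nbhsl.
  rewrite /Rintegral.
  under [X in fine X]eq_integral do rewrite /= fineK//.
  rewrite -qnu//.
  rewrite [X in fine X](_ : _ = mug (`]-oo, y] `&` D))//.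
  rewrite [X in mug X](_ : _ = `]- n%:R, y]%classic).
    rewrite /mug/= lebesgue_stieltjes_measure_oc/=; last by case/andP: yn => /ltW.
    rewrite /g; ring.
  apply/seteqP; split=> z /=; rewrite /D/= !in_itv/=.
    by move=> [-> /andP[->]].
  by move=> /andP[-> zy]; split => //=; rewrite (le_trans zy)//; case/andP: yn => _ /ltW.
apply: derivableD => //.
Unshelve. all: by end_near. Qed.

Lemma half_lipschitz_ae_derivable :
  {ae @lebesgue_measure R, forall x, derivable f x 1}.
Proof.
have : {ae @lebesgue_measure R, forall x (n : nat),
    `]- n%:R, n%:R[%classic x -> derivable f x 1}.
  by apply/ae_foralln => n; exact: half_ae_derivable_on.
move/ae_imp; apply => x /(_ (Num.bound `|x|)); apply.
by rewrite /= in_itv/= -ltr_norml archi_boundP.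
Qed.

End lipschitz_derivable_half.

Lemma lipschitz_ae_derivable (R : realType) (f : R -> R) (M : R) :
  (forall x y, `|f x - f y| <= M * `|x - y|) ->
  {ae @lebesgue_measure R, forall x, derivable f x 1}.
Proof.
(* Dividing by [c] makes the function 1/2-Lipschitz; the summand 1 keeps [c] positive whatever the
   sign of [M]. *)
move=> fM; pose c := (`|M| + 1) * 2.
have c0 : 0 < c by rewrite mulr_gt0// ltr_wpDl.
have : {ae @lebesgue_measure R, forall x, derivable (fun x => c^-1 * f x) x 1}.
  apply: half_lipschitz_ae_derivable => x y.
  rewrite -mulrBr normrM gtr0_norm ?invr_gt0// ler_pdivrMl//.
  rewrite (le_trans (fM _ _))// mulrA ler_wpM2r//.
  rewrite /c -mulrA divff// mulr1; have := ler_norm M; lra.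
move/ae_imp; apply => x /(@derivableZ _ _ _ _ c).
rewrite (_ : _ \*: _ = f)//; apply/funext => y /=.
by rewrite /GRing.scale/= mulrA divff ?gt_eqF// mul1r.
Qed.

Lemma small_invS (R : archiRealFieldType) (e : R) : 0 < e ->
  exists m : nat, m.+1%:R^-1 < e.
Proof.
move=> e0; have ei0 : 0 < e^-1 by rewrite invr_gt0.
exists (Num.bound e^-1); rewrite -[ltRHS]invrK ltf_pV2 ?posrE//.
by rewrite (lt_trans (archi_boundP (ltW ei0)))// ltr_nat.
Qed.

(** * Topology and Lebesgue measure on row vectors *)

Section rV_norm.
Context {R : realType} {n : nat}.
Implicit Types x y : 'rV[R]_n.

Lemma coord_le_norm x i : `|x ord0 i| <= `|x|.
Proof.
rewrite [leRHS]/Num.norm/= mx_normrE; apply/bigmax_geP; right => /=.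
by exists (ord0, i).
Qed.

Lemma norm_rV_le x e : 0 <= e -> (forall i, `|x ord0 i| <= e) -> `|x| <= e.
Proof.
move=> e0 xe; rewrite [leLHS]/Num.norm/= mx_normrE; apply/bigmax_leP.
by split=> // -[i j] _ /=; rewrite (ord1 i).
Qed.

Lemma norm_rV_ltP x e : 0 < e -> (`|x| < e) <-> (forall i, `|x ord0 i| < e).
Proof.
move=> e0; split=> [xe i|xe]; first exact: le_lt_trans (coord_le_norm _ _) xe.
rewrite [ltLHS]/Num.norm/= mx_normrE; apply/bigmax_ltP.
by split=> // -[i j] _ /=; rewrite (ord1 i).
Qed.

Lemma dense_rat_rV x e : 0 < e ->
  exists q : 'rV[rat]_n, `|x - map_mx ratr q| < e.
Proof.
move=> e0.
have /choice[q qE] : forall i, exists q : rat, ratr q \in `]x ord0 i - e, x ord0 i + e[.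
  by move=> i; apply: rat_in_itvoo; lra.
exists (\row_i q i); apply/norm_rV_ltP => // i; rewrite !mxE.
by have := qE i; rewrite in_itv/= ltr_norml => /andP[? ?]; apply/andP; split; lra.
Qed.

Lemma measurable_rV_box (A : 'I_n -> set R) :
  (forall i, measurable (A i)) ->
  measurable [set x : 'rV[R]_n | forall i, A i (x ord0 i)].
Proof.
move=> mA; rewrite (_ : mkset _ = \bigcap_(i in [set: 'I_n])
    ((fun x : 'rV[R]_n => x ord0 i) @^-1` A i)).
  apply: fin_bigcap_measurable => // i _; rewrite -[X in measurable X]setTI.
  exact: (measurable_coord i measurableT (mA i)).
by apply/seteqP; split => [x Ax i _|x Ax i]; [exact: Ax|exact: (Ax i I)].
Qed.

Lemma measurable_rV_ball x e : measurable [set y : 'rV[R]_n | `|y - x| < e].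
Proof.
have [e0|e0] := ltP 0 e; last first.
  rewrite (_ : mkset _ = set0)//; apply/seteqP; split=> // y /= ye.
  by have := le_lt_trans (normr_ge0 _) (lt_le_trans ye e0); rewrite ltxx.
rewrite (_ : mkset _ = [set y : 'rV[R]_n | forall i,
    `]x ord0 i - e, x ord0 i + e[%classic (y ord0 i)]).
  exact: (measurable_rV_box (fun i => measurable_itv
    `]x ord0 i - e, x ord0 i + e[)).
apply/seteqP; split=> y /=.
  move=> /(norm_rV_ltP _ e0) H i; have := H i.
  by rewrite /= in_itv/= !mxE ltr_norml => /andP[? ?]; apply/andP; split; lra.
move=> H; apply/(norm_rV_ltP _ e0) => i; have := H i.
by rewrite /= in_itv/= !mxE ltr_norml => /andP[? ?]; apply/andP; split; lra.
Qed.

(** The sigma-algebra is generated by coordinates, so an open set is written as the union of the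
    countably many rational sup-norm balls it contains, and such balls are boxes. *)
Lemma open_measurable_rV (A : set 'rV[R]_n) : open A -> measurable A.
Proof.
move=> oA; pose r (qm : 'rV[rat]_n * nat) : set 'rV[R]_n :=
  [set y | `|y - map_mx ratr qm.1| < qm.2.+1%:R^-1].
rewrite (_ : A = \bigcup_qm (if `[< r qm `<=` A >] then r qm else set0)).
  apply: countable_bigcupT_measurable => // -[q m].
  by case: ifP => // _; exact: measurable_rV_ball.
apply/seteqP; split=> [x Ax|x [qm _]]; last by case: asboolP => // + rx; apply.
have /nbhs_ballP[e /= e0 eA] : nbhs x A by exact: open_nbhs_nbhs.
have [m me] := small_invS (divr_gt0 e0 (ltr0Sn R 1)).
have m0 : 0 < m.+1%:R^-1 :> R by [].
have [q qx] := dense_rat_rV x m0.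
exists (q, m) => //; have -> : `[< r (q, m) `<=` A >].
  apply/asboolP => y ry; apply: eA; rewrite -ball_normE/=.
  rewrite -(subrK (map_mx ratr q) x) -addrA (le_lt_trans (ler_normD _ _))//.
  move: ry; rewrite /r/= distrC => ry.
  by rewrite [e]splitr ltrD ?(lt_trans _ me).
exact: qx.
Qed.

Lemma continuous_measurable_rV (f : 'rV[R]_n -> R) :
  continuous f -> measurable_fun setT f.
Proof.
move=> /continuousP cf; apply: (measurability _ (RGenOpens.measurableE R)).
move=> _ [_ [a [b ->] <-]]; rewrite setTI.
by apply: open_measurable_rV; exact/cf/interval_open.
Qed.

Lemma measurable_rV_shift v : measurable_fun setT (fun x : 'rV[R]_n => x + v).
Proof.
apply/measurable_fun_rVP => i.
rewrite (_ : (fun _ => _) = fun x : 'rV[R]_n => x ord0 i + v ord0 i); last first.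
  by apply/funext => x; rewrite mxE.
by apply: measurable_funD => //; exact: measurable_coord.
Qed.

Lemma compact_norm_le (K : R) : compact [set x : 'rV[R]_n | `|x| <= K].
Proof.
apply: bounded_closed_compact.
  exists K; split; first exact: num_real.
  by move=> r r1 w /= w1; rewrite (le_trans w1)// ltW.
rewrite (_ : mkset _ = (fun w : 'rV[R]_n => `|w|) @^-1` [set r | r <= K])//.
by apply: closed_comp => [w _|]; [exact: norm_continuous|exact: closed_le].
Qed.

End rV_norm.

(** * Translation invariance of Lebesgue measure and integral *)

Section translation.
Context {R : realType}.

Lemma lebesgue_measure_shift (a : R) (A : set (measurableTypeR R)) :
  measurable A ->
  @lebesgue_measure R ((fun x => x + a) @^-1` A) = lebesgue_measure A.
Proof.
move=> mA.
have ms : measurable_fun setT (fun x : measurableTypeR R => (x + a : measurableTypeR R)).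
  by apply: measurable_funD.
pose ms1 := isMeasurableFun.Build _ _ _ _ _ ms.
pose s : {mfun measurableTypeR R >-> measurableTypeR R} := HB.pack (fun x => x + a) ms1.
apply/esym.
apply: (lebesgue_measure_unique (mu := pushforward lebesgue_measure s)) => //.
move=> _ [[c d] _ <-]; rewrite /pushforward/=.
rewrite [X in _ = lebesgue_measure X](_ : _ = `]c - a, d - a]%classic); last first.
  by apply/seteqP; split=> x /=; rewrite !in_itv/= ltrBlDr lerBrDr.
by rewrite !lebesgue_measure_itv/= !lte_fin ltrD2r -!EFinD; case: ifP => // _;
  congr (_%:E); ring.
Qed.

(** Induction on the dimension: the induction hypothesis translates each section, and
    one-dimensional invariance translates the outer integral over the first coordinate. *)
Lemma lebesgue_rV_shift n (v : 'rV[R]_n) (A : set 'rV[R]_n) :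
  measurable A ->
  lebesgue_rV n ((fun x => x + v) @^-1` A) = lebesgue_rV n A.
Proof.
elim: n v A => [|n IH] v A mA.
  rewrite (_ : _ @^-1` _ = A)//; apply/seteqP.
  by split => x /=; rewrite (_ : x + v = x)//; apply/rowP => -[].
rewrite /= /lebesgue_rV_step /pushforward /product_measure1/=.
pose B := @cons_rV R n @^-1` A.
have mB : measurable B.
  by rewrite -[B]setTI; apply: measurable_cons_rV.
pose a := v ord0 ord0; pose w : 'rV[R]_n := rsubmx (v : 'rV_(1 + n)).
transitivity (\int[@lebesgue_measure R]_x
    ((lebesgue_rV n \o xsection B) \o (fun t : R => (t + a)%R)) x)%E.
  apply: eq_integral => t _ /=.
  rewrite -(IH w (xsection B (t + a)%R)); last exact: measurable_xsection.
  congr (lebesgue_rV n _); apply/seteqP; split=> y; rewrite /xsection/= !inE/=.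
    rewrite /B/= (_ : cons_rV (t, y) + v = cons_rV (t + a, y + w))//.
    apply/rowP => i; rewrite mxE; have [j ->|->] := unliftP ord0 i.
      by rewrite !cons_rVS/= !mxE; congr (_ + v _ _); exact: val_inj.
    by rewrite !cons_rV0.
  rewrite /B/= (_ : cons_rV (t, y) + v = cons_rV (t + a, y + w))//.
  apply/rowP => i; rewrite mxE; have [j ->|->] := unliftP ord0 i.
    by rewrite !cons_rVS/= !mxE; congr (_ + v _ _); exact: val_inj.
  by rewrite !cons_rV0.
have ms : measurable_fun setT (fun x : measurableTypeR R => (x + a : measurableTypeR R)).
  by apply: measurable_funD.
transitivity (\int[pushforward (@lebesgue_measure R)
    (fun x : measurableTypeR R => (x + a : measurableTypeR R)%R)]_x
    ((lebesgue_rV n \o xsection B) x))%E.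
  rewrite ge0_integral_pushforward//; exact: measurable_fun_xsection.
apply: eq_measure_integral => C mC _.
exact: lebesgue_measure_shift.
Qed.

Lemma ge0_integral_shift n (v : 'rV[R]_n) (f : 'rV[R]_n -> \bar R) :
  measurable_fun setT f -> (forall x, 0 <= f x)%E ->
  (\int[lebesgue_rV n]_x f (x + v)%R = \int[lebesgue_rV n]_x f x)%E.
Proof.
move=> mf f0.
have ms := measurable_rV_shift v.
transitivity (\int[pushforward (lebesgue_rV n)
    (fun x : 'rV[R]_n => (x + v)%R)]_x f x)%E.
  by rewrite ge0_integral_pushforward.
by apply: eq_measure_integral => C mC _; exact: lebesgue_rV_shift.
Qed.

Lemma integral_shift n (v : 'rV[R]_n) (f : 'rV[R]_n -> \bar R) :
  measurable_fun setT f ->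
  (\int[lebesgue_rV n]_x f (x + v)%R = \int[lebesgue_rV n]_x f x)%E.
Proof.
move=> mf; rewrite [LHS]integralE [RHS]integralE.
have := ge0_integral_shift v (measurable_funepos mf) (funepos_ge0 _).
have := ge0_integral_shift v (measurable_funeneg mf) (funeneg_ge0 _).
by move=> /= <- <-; congr (_ - _)%E; apply: eq_integral => x _; rewrite ?funeposE ?funenegE.
Qed.

Lemma integrable_shift n (v : 'rV[R]_n) (f : 'rV[R]_n -> \bar R) :
  (lebesgue_rV n).-integrable setT f ->
  (lebesgue_rV n).-integrable setT (fun x => f (x + v)).
Proof.
move=> /integrableP[mf fi]; apply/integrableP; split.
  exact: (measurableT_comp mf (measurable_rV_shift v)).
rewrite (ge0_integral_shift v (f := fun x => `|f x|%E))//.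
exact: measurableT_comp.
Qed.

End translation.

(** * Existence of directional derivatives *)

Lemma ae_forall_countable d (T : measurableType d) (R : realType)
    (mu : {measure set T -> \bar R}) (I : countType) (P : I -> T -> Prop) :
  (forall i, {ae mu, forall x, P i x}) -> {ae mu, forall x, forall i, P i x}.
Proof.
move=> aeP.
have : {ae mu, forall x (n : nat), if unpickle n is Some i then P i x else True}.
  apply/ae_foralln => n; case: (unpickle n) => [i|]; first exact: aeP.
  exact: aeW.
by move/ae_imp; apply => x Px i; have := Px (pickle i); rewrite pickleK.
Qed.

Section cauchy_rational.
Context {R : realType}.
Implicit Types u : R -> R.

Lemma near_rat (x : R) (A : set R) : nbhs x A -> exists q : rat, A (ratr q).
Proof.
move=> /nbhs_ballP[e /= e0 eA].
have [|q] := @rat_in_itvoo R (x - e) (x + e); first by lra.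
rewrite in_itv/= => /andP[qa qb]; exists q; apply: eA.
by rewrite -ball_normE/= ltr_norml; apply/andP; split; lra.
Qed.

(** The Cauchy criterion at 0 with countable quantifiers only. Continuity away from 0 carries the
    estimate from rational to real arguments, up to an arbitrary d > 0. This form makes the
    existence of a limit a measurable condition on parameters. *)
Lemma cvg_dnbhs0_ratP u : (forall h, h != 0 -> {for h, continuous u}) ->
  cvg (u @ 0^') <-> forall m : nat, exists n : nat, forall st : rat * rat,
    0 < `|ratr st.1 : R| < n.+1%:R^-1 -> 0 < `|ratr st.2 : R| < n.+1%:R^-1 ->
    `|u (ratr st.1) - u (ratr st.2)| <= m.+1%:R^-1.
Proof.
move=> cu; split.
  move=> /cvg_ex[l ul] m.
  have m20 : 0 < m.+1%:R^-1 / 2 :> R by rewrite divr_gt0.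
  have : \forall h \near 0^', `|l - u h| < m.+1%:R^-1 / 2.
    by move/cvgrPdist_lt : ul => /(_ _ m20).
  rewrite /dnbhs /within/= => /nbhs_ballP[e /= e0 eP].
  have [n ne] := small_invS e0.
  exists n => -[s t]/= /andP[s0 sn] /andP[t0 tn].
  have us : `|l - u (ratr s)| < m.+1%:R^-1 / 2.
    apply: eP; last by rewrite -normr_gt0.
    by rewrite -ball_normE/= sub0r normrN (lt_trans sn).
  have ut : `|l - u (ratr t)| < m.+1%:R^-1 / 2.
    apply: eP; last by rewrite -normr_gt0.
    by rewrite -ball_normE/= sub0r normrN (lt_trans tn).
  rewrite -(subrKA l) (le_trans (ler_normD _ _))// [leRHS]splitr lerD//.
    by rewrite distrC ltW.
  by rewrite ltW.
move=> uP; apply/cauchy_cvgP/cauchy_ballP => e e0.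
have [m me] := small_invS e0; have [n nP] := uP m.
have cst (h k : R) : 0 < `|h| < n.+1%:R^-1 -> 0 < `|k| < n.+1%:R^-1 ->
    `|u h - u k| <= m.+1%:R^-1.
  move=> /andP[h0 hn] /andP[k0 kn]; apply/ler_addgt0Pr => d d0.
  have d2 : 0 < d / 2 by rewrite divr_gt0.
  have ratapprox (z : R) : 0 < `|z| -> `|z| < n.+1%:R^-1 -> exists q : rat,
      0 < `|ratr q : R| < n.+1%:R^-1 /\ `|u z - u (ratr q)| < d / 2.
    move=> z0 zn; apply: (@near_rat z (fun q => 0 < `|q| < n.+1%:R^-1 /\
      `|u z - u q| < d / 2)).
    have zneq : z != 0 by rewrite -normr_gt0.
    near=> q; split; last first.
      by near: q; move/cvgrPdist_lt : (cu _ zneq); exact.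
    apply/andP; split.
      rewrite normr_gt0; near: q.
      exact: (open_nbhs_nbhs (conj (@open_neq _ (0:R)) zneq)).
    near: q; apply: (cvgr_lt `|z|) => //; exact: norm_continuous.
  have [s [sn us]] := ratapprox h h0 hn.
  have [t [tn ut]] := ratapprox k k0 kn.
  have := nP (s, t) sn tn => /= st.
  have -> : u h - u k = (u h - u (ratr s)) + (u (ratr s) - u (ratr t)) +
    (u (ratr t) - u k) by ring.
  rewrite (le_trans (ler_normD _ _))// (le_trans (lerD (ler_normD _ _) (lexx _)))//.
  rewrite distrC in ut.
  rewrite [d in leRHS]splitr addrCA addrA.
  by rewrite !lerD// ltW.
have nn0 : 0 < n.+1%:R^-1 :> R by [].
pose S : set R := [set h | 0 < `|h| < n.+1%:R^-1].
have S0 : \forall h \near 0^', S h.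
  near=> h; apply/andP; split; last by near: h; exact: dnbhs0_lt.
  by rewrite normr_gt0; near: h; exact: nbhs_dnbhs_neq.
exists (u @` S, u @` S).
  by split; apply: filterS S0 => h Sh; exists h.
move=> [_ _] /= [[h hn <-] [k kn <-]]; rewrite -ball_normE/=.
by rewrite (le_lt_trans _ me)// cst.
Unshelve. all: by end_near. Qed.

End cauchy_rational.

Lemma dist_le_continuous (R : realType) (V W : normedModType R) (f : V -> W)
    (M : R) :
  (forall x y, `|f x - f y| <= M * `|x - y|) -> continuous f.
Proof.
move=> fM x; apply/cvgrPdist_le => e e0.
have M0 : 0 < `|M| + 1 by rewrite ltr_wpDl.
near=> y; rewrite (le_trans (fM _ _))//.
rewrite (@le_trans _ _ ((`|M| + 1) * `|x - y|))//.
  by rewrite ler_wpM2r// (le_trans (ler_norm _))// lerDl.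
rewrite -ler_pdivlMl//; near: y; apply: cvgr_dist_le => //.
by rewrite mulr_gt0// invr_gt0.
Unshelve. all: by end_near. Qed.

Section directional_derivative.
Context {R : realType} {n : nat}.
Implicit Types (f : 'rV[R]_n -> R) (x v : 'rV[R]_n).

Lemma continuous_rV_line x v : continuous (fun h : R => h *: v + x).
Proof.
move=> h; apply: cvgD; [|exact: cvg_cst].
exact: scalel_continuous.
Qed.

Lemma continuous_rV_translate v : continuous (fun x => v + x).
Proof.
move=> x; exact: (@cvgD _ _ _ (nbhs x) _ (cst v) id v x (cvg_cst v) cvg_id).
Qed.

(** By the rational Cauchy criterion the set is a countable intersection of countable unions of
    countable intersections of sets [A m N st]; a pair [st] that is not within the punctured range
    imposes no condition, hence [setT]. *)
Lemma measurable_derivable f v : continuous f ->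
  measurable [set x | derivable f x v].
Proof.
move=> cf; pose q (h : R) x := h^-1 * (f (h *: v + x) - f x).
have mq h : measurable_fun setT (q h).
  apply: measurable_funM => //; apply: measurable_funB; last first.
    exact: continuous_measurable_rV.
  apply: continuous_measurable_rV => x; apply: continuous_comp; last exact: cf.
  exact: continuous_rV_translate.
pose A (m N : nat) (st : rat * rat) : set 'rV[R]_n :=
  if (0 < `|ratr st.1 : R| < N.+1%:R^-1) && (0 < `|ratr st.2 : R| < N.+1%:R^-1)
  then (fun x => `|q (ratr st.1) x - q (ratr st.2) x|) @^-1` `]-oo, m.+1%:R^-1]
  else setT.
rewrite (_ : mkset _ = \bigcap_m \bigcup_N \bigcap_st A m N st).
  apply: bigcap_measurable => // m _; apply: bigcup_measurable => N _.
  rewrite -[X in measurable X]setCK setC_bigcap; apply: measurableC.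
  apply: countable_bigcupT_measurable => // st; apply: measurableC.
  rewrite /A; case: ifP => // _; rewrite -[X in measurable X]setTI.
  suff mh : measurable_fun setT (fun x => `|q (ratr st.1) x - q (ratr st.2) x|).
    by apply: mh => //; exact: measurable_itv.
  by apply: measurableT_comp => //; exact: measurable_funB.
have qc x h : h != 0 -> {for h, continuous (q^~ x)}.
  move=> h0; apply: cvgM; first by apply: cvgV => //; exact: cvg_id.
  apply: cvgB; last exact: cvg_cst.
  by apply: continuous_comp; [exact: continuous_rV_line|exact: cf].
apply/seteqP; split=> x /=.
  move=> /(cvg_dnbhs0_ratP (qc x)) H m _; have [N HN] := H m.
  exists N => // -[s t] _; rewrite /A/=; case: ifP => // /andP[sN tN].
  by rewrite /= in_itv/=; exact: (HN (s, t)).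
move=> H; apply/(cvg_dnbhs0_ratP (qc x)) => m; have [N _ HN] := H m I.
exists N => -[s t] /= sN tN; have := HN (s, t) I.
by rewrite /A/= sN tN/= in_itv.
Qed.

(** The difference quotient with step 1/(m+1): a sequence rather than a family indexed by real
    steps, so that dominated convergence applies. *)
Definition dquot f v (m : nat) x : R := m.+1%:R * (f (m.+1%:R^-1 *: v + x) - f x).

Lemma measurable_dquot f v m : continuous f -> measurable_fun setT (dquot f v m).
Proof.
move=> cf; apply: measurable_funM => //.
apply: measurable_funB; last exact: continuous_measurable_rV.
apply: continuous_measurable_rV => x; apply: continuous_comp; last exact: cf.
exact: continuous_rV_translate.
Qed.

Lemma cvg_dquot f v x : derivable f x v ->
  dquot f v m x @[m --> \oo] --> 'D_v f x.
Proof.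
move=> Dx.
have /cvgr_dnbhsP/(_ (fun m => m.+1%:R^-1)) H :
  (fun h => h^-1 * (f (h *: v + x) - f x)) h @[h --> 0^'] --> 'D_v f x by exact: Dx.
have {}H := H (conj (fun m => lt0r_neq0 (_ : 0 < m.+1%:R^-1)) (@cvg_harmonic R)).
rewrite (_ : (dquot f v)^~ x = fun m => m.+1%:R^-1^-1 * (f (m.+1%:R^-1 *: v + x) - f x)).
  by apply: H.
by apply/funext => m; rewrite /dquot invrK.
Qed.

Lemma dquot_le f v m x C :
  (forall h, `|f (h *: v + x) - f x| <= C * `|h|) -> `|dquot f v m x| <= C.
Proof.
move=> fC; rewrite /dquot normrM ger0_norm// mulrC -ler_pdivlMr//.
by rewrite (le_trans (fC _))// ger0_norm.
Qed.

Lemma derive_le f v x C :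
  (forall h, `|f (h *: v + x) - f x| <= C * `|h|) -> `|'D_v f x| <= C.
Proof.
(* Where the derivative does not exist its default value is 0, and the hypothesis at h = 1 forces
   [C] to be nonnegative. *)
move=> fC; have [dx|ndx] := pselect (derivable f x v); last first.
  rewrite /derive dvgP// normr0.
  by have := le_trans (normr_ge0 _) (fC 1); rewrite normr1 mulr1.
have /cvg_norm := cvg_dquot dx.
move/cvg_lim => <- //; apply: limr_le.
  by apply/cvg_ex; exists `|'D_v f x|; apply: cvg_norm; exact: cvg_dquot.
by apply: nearW => m; exact: dquot_le.
Qed.

(** On the measurable set of derivability this is the pointwise limit of [dquot]; on the complement
    it is the constant default value. *)
Lemma measurable_derive f v : continuous f -> measurable_fun setT ('D_v f).
Proof.
move=> cf; pose D := [set x | derivable f x v].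
have mD : measurable D by exact: measurable_derivable.
rewrite -(setUv D); apply/measurable_funU => //; first exact: measurableC.
split; last first.
  apply: (eq_measurable_fun (cst point)) => // x; rewrite inE => ndx.
  by rewrite /= /derive dvgP.
apply: (measurable_fun_cvg (h := dquot f v)) => [m|x Dx]; last exact: cvg_dquot.
by apply: measurable_funTS; exact: measurable_dquot.
Qed.

Lemma derivable_lineE f x v (t : R) :
  derivable (fun s : R => f (s *: v + x)) t 1 <-> derivable f (t *: v + x) v.
Proof.
rewrite /derivable; set g1 := fun h => h^-1 *: _; set g2 := fun h => h^-1 *: _.
suff -> : g1 = g2 by [].
apply/funext => h; rewrite /g1 /g2 /=; congr (_ *: (f _ - _)).
by rewrite [h%:A]mulr1 scalerDl addrA.
Qed.

Lemma derive_lineE f x v (t : R) :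
  'D_1 (fun s : R => f (s *: v + x)) t = 'D_v f (t *: v + x).
Proof.
rewrite /derive; set g1 := fun h => h^-1 *: _; set g2 := fun h => h^-1 *: _.
suff -> : g1 = g2 by [].
apply/funext => h; rewrite /g1 /g2 /=; congr (_ *: (f _ - _)).
by rewrite [h%:A]mulr1 scalerDl addrA.
Qed.

(* By translation invariance the t-section of {(t, x) | t v + x \in N} has
   the measure of N for every t, while its x-sections are null by the
   one-dimensional theorem; so lambda(N) * (+oo) = 0. *)
Lemma lipschitz_ae_derivable_rV f v (M : R) :
  (forall x y, `|f x - f y| <= M * `|x - y|) ->
  {ae lebesgue_rV n, forall x, derivable f x v}.
Proof.
move=> fM.
have cf : continuous f by exact: dist_le_continuous fM.
pose N := ~` [set x | derivable f x v].
have mN : measurable N by apply: measurableC; exact: measurable_derivable.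
exists N; split => //; apply/eqP; rewrite eq_le measure_ge0 andbT leNgt.
apply/negP => N0.
pose s (tx : measurableTypeR R * 'rV[R]_n) : 'rV[R]_n := tx.1 *: v + tx.2.
have ms : measurable_fun setT s.
  apply/measurable_fun_rVP => i.
  rewrite (_ : (fun _ => _) = fun tx : measurableTypeR R * 'rV[R]_n =>
     (tx.1 : R) * v ord0 i + tx.2 ord0 i); last first.
    by apply/funext => tx; rewrite !mxE.
  apply: measurable_funD; first by apply: measurable_funM => //; exact: measurable_fst.
  exact: (measurableT_comp (measurable_coord i) measurable_snd).
pose E := s @^-1` N.
have mE : measurable E by rewrite -[E]setTI; exact: ms.
have : (@lebesgue_measure R \x lebesgue_rV n)%E E = 0%E.
  rewrite (product_measure_unique
    (m' := (@lebesgue_measure R \x^ lebesgue_rV n)%E))//; last first.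
    by move=> A B mA mB; exact: product_measure2E.
  rewrite /product_measure2; apply: integral0_eq => x _ /=.
  have fl : forall t u : R, `|f (t *: v + x) - f (u *: v + x)| <= (M * `|v|) * `|t - u|.
    move=> t u; rewrite (le_trans (fM _ _))//.
    by rewrite opprD addrACA subrr addr0 -scalerBl normrZ mulrAC -mulrA.
  have [C [mC C0 NC]] := lipschitz_ae_derivable fl.
  apply/eqP; rewrite eq_le measure_ge0 andbT -C0 le_measure ?inE//.
    exact: measurable_ysection.
  move=> t; rewrite /ysection/= inE /E /N /s/= => nd; apply: NC => /=.
  by move=> /derivable_lineE.
rewrite /product_measure1/=.
rewrite (eq_integral (cst (lebesgue_rV n N))); last first.
  move=> t _ /=; rewrite -[RHS](lebesgue_rV_shift (t *: v))//.
  congr (lebesgue_rV n _); apply/seteqP.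
  by split=> x; rewrite /xsection/= inE /E/s/= addrC.
rewrite integral_cst//= => /eqP; rewrite mule_eq0 (gt_eqF N0)/=.
rewrite -set_itvNyy lebesgue_measure_itv//=.
Qed.

End directional_derivative.

(** * Truncation and locally Lipschitz functions *)

Section clamp.
Context {R : realType}.
Implicit Types c r t u : R.

Definition clamp c r t : R := Num.max (c - r) (Num.min (c + r) t).

Lemma clamp_id c r t : `|t - c| <= r -> clamp c r t = t.
Proof.
rewrite ler_norml => /andP[tc ct]; rewrite /clamp min_r ?max_r//; lra.
Qed.

Lemma clamp_in c r t : 0 <= r -> `|clamp c r t - c| <= r.
Proof.
move=> r0; rewrite ler_norml /clamp /Num.max /Num.min.
by case: ifPn; case: ifPn; rewrite -?leNgt => *; apply/andP; split; lra.
Qed.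

Lemma clamp_lip c r t u : `|clamp c r t - clamp c r u| <= `|t - u|.
Proof.
wlog tu : t u / t <= u.
  move=> H; have [tu|ut] := leP t u; first exact: H.
  by rewrite distrC (distrC t) H// ltW.
rewrite distrC (distrC t) (ger0_norm (_ : 0 <= u - t)) ?subr_ge0//.
rewrite ler_norml /clamp /Num.max /Num.min.
by do ![case: ifPn]; rewrite -?leNgt => *; apply/andP; split; lra.
Qed.

End clamp.

Lemma near_dist_lt (R : realType) (V : normedModType R) (x c : V) (r : R) :
  `|x - c| < r -> \forall y \near x, `|y - c| < r.
Proof.
move=> xr; apply/nbhs_ballP; exists (r - `|x - c|); first by rewrite /= subr_gt0.
move=> y; rewrite -ball_normE/= => xy.
rewrite -(subrKA x) (le_lt_trans (ler_normD _ _))// distrC.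
by rewrite -ltrBrDr.
Qed.

Definition locally_dist_le (R : realType) (V W : normedModType R) (f : V -> W) :=
  forall x, exists M r, 0 < r /\
    forall y z, `|y - x| < r -> `|z - x| < r -> `|f y - f z| <= M * `|y - z|.

(* In locally_lipschitz the phantom of [locally ...] unifies with setT `*` setT,
   so that the condition ranges over pairs of points; the diagonal ones are the
   usual local Lipschitz condition. *)
Lemma locally_lipschitz_dist_le (R : realType) (V W : normedModType R)
  (f : V -> W) : locally_lipschitz f -> locally_dist_le f.
Proof.
move=> fl x; have := fl (x, x) (conj I I).
rewrite /lipschitz_on => -[M0 [_ M0P]].
have M01 : M0 < M0 + 1 by rewrite ltrDl.
have := M0P _ M01.
move=> -[[A B] /= [/nbhs_ballP[a /= a0 aA] /nbhs_ballP[b /= b0 bB]]] AB.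
exists (M0 + 1), (Num.min a b); split; first by rewrite lt_min a0.
move=> y z; rewrite !lt_min => /andP[ya _] /andP[_ zb].
apply: (AB (y, z)); split => //=.
  by apply: aA; rewrite -ball_normE/= distrC.
by apply: bB; rewrite -ball_normE/= distrC.
Qed.

Lemma locally_dist_le_continuous (R : realType) (V W : normedModType R)
  (f : V -> W) : locally_dist_le f -> continuous f.
Proof.
move=> fl x; have [M [r [r0 fM]]] := fl x; apply/cvgrPdist_le => e e0.
have M0 : 0 < `|M| + 1 by rewrite ltr_wpDl.
near=> y; have yr : `|y - x| < r.
  by near: y; apply: near_dist_lt; rewrite subrr normr0.
have xr : `|x - x| < r by rewrite subrr normr0.
rewrite (le_trans (fM _ _ xr yr))//.
rewrite (@le_trans _ _ ((`|M| + 1) * `|x - y|))//.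
  by rewrite ler_wpM2r// (le_trans (ler_norm _))// lerDl.
rewrite -ler_pdivlMl//; near: y; apply: cvgr_dist_le => //.
by rewrite mulr_gt0// invr_gt0.
Unshelve. all: by end_near. Qed.

Section locally_lipschitz_ae_derivable.
Context {R : realType} {n : nat}.

(** A countable base of balls. The closed rational ball, not just the open one, has to stay within r
    of x, because clamping onto a ball reaches its boundary. *)
Lemma rat_ball_basis (x : 'rV[R]_n) (r : R) : 0 < r ->
  exists qm : 'rV[rat]_n * nat, `|x - map_mx ratr qm.1| < qm.2.+1%:R^-1 /\
    forall y, `|y - map_mx ratr qm.1| <= qm.2.+1%:R^-1 -> `|y - x| < r.
Proof.
move=> r0; have [m mr] := small_invS (divr_gt0 r0 (ltr0Sn R 1)).
have m0 : 0 < m.+1%:R^-1 :> R by [].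
have [q qx] := dense_rat_rV x m0.
exists (q, m); split => //= y yq.
rewrite -(subrKA (map_mx ratr q)) (le_lt_trans (ler_normD _ _))//.
by rewrite [r]splitr ltrD// ?(le_lt_trans yq)// distrC (lt_trans qx).
Qed.

(** A 1-Lipschitz retraction onto the closed sup-norm ball: composing with it turns a function that
    is Lipschitz on the ball into a globally Lipschitz one. *)
Definition clamp_rV (c : 'rV[R]_n) (r : R) (x : 'rV[R]_n) : 'rV[R]_n :=
  \row_i clamp (c ord0 i) r (x ord0 i).

Lemma clamp_rV_lip c r x y : `|clamp_rV c r x - clamp_rV c r y| <= `|x - y|.
Proof.
apply: norm_rV_le => // i; rewrite !mxE (le_trans (clamp_lip _ _ _ _))//.
by have := coord_le_norm (x - y) i; rewrite !mxE.
Qed.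

Lemma clamp_rV_id c r x : `|x - c| <= r -> clamp_rV c r x = x.
Proof.
move=> xc; apply/rowP => i; rewrite mxE clamp_id// (le_trans _ xc)//.
by have := coord_le_norm (x - c) i; rewrite !mxE.
Qed.

Lemma clamp_rV_in c r x : 0 <= r -> `|clamp_rV c r x - c| <= r.
Proof.
by move=> r0; apply: norm_rV_le => // i; rewrite !mxE clamp_in.
Qed.

(** Countably many rational balls on which [f] is Lipschitz cover the space. On each of them [f]
    composed with the clamp is globally Lipschitz and coincides with [f] near every point of the
    open ball. *)
Lemma locally_lipschitz_ae_derivable (f : 'rV[R]_n -> R) (v : 'rV[R]_n) :
  locally_dist_le f -> {ae lebesgue_rV n, forall x, derivable f x v}.
Proof.
move=> fl; pose c (qm : 'rV[rat]_n * nat) : 'rV[R]_n := map_mx ratr qm.1.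
pose r (qm : 'rV[rat]_n * nat) : R := qm.2.+1%:R^-1.
pose good qm := exists M, forall y z, `|y - c qm| <= r qm ->
  `|z - c qm| <= r qm -> `|f y - f z| <= M * `|y - z|.
have : {ae lebesgue_rV n, forall x qm, good qm -> `|x - c qm| < r qm ->
    derivable f x v}.
  apply: ae_forall_countable => qm.
  have [[M fM]|ng] := pselect (good qm); last by apply: aeW => x /ng.
  have r0 : 0 < r qm by rewrite /r invr_gt0.
  have : {ae lebesgue_rV n, forall x, derivable (f \o clamp_rV (c qm) (r qm)) x v}.
    apply: (@lipschitz_ae_derivable_rV _ _ _ _ `|M|) => x y.
    have cin z : `|clamp_rV (c qm) (r qm) z - c qm| <= r qm by exact: clamp_rV_in (ltW r0).
    rewrite (le_trans (fM _ _ (cin x) (cin y)))//.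
    rewrite (@le_trans _ _ (`|M| * `|clamp_rV (c qm) (r qm) x - clamp_rV (c qm) (r qm) y|))//.
      by rewrite ler_wpM2r// ler_norm.
    by rewrite ler_wpM2l// clamp_rV_lip.
  move/ae_imp; apply => x dx _ xr; apply: near_eq_derivable dx.
  have : \forall y \near x, `|y - c qm| < r qm by exact: near_dist_lt.
  apply: filterS => y yr /=.
  by rewrite clamp_rV_id// ltW.
move/ae_imp; apply => x H.
have [M [d [d0 fM]]] := fl x.
have [qm [xq qP]] := rat_ball_basis x d0.
by apply: (H qm) => //; exists M => y z /qP yd /qP zd; exact: fM.
Qed.

End locally_lipschitz_ae_derivable.

Section pointwise_continuity.
Context {R : realType} {X : topologicalType}.
Implicit Types f g : X -> R.

Lemma continuous_maxr f g : continuous f -> continuous g ->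
  continuous (fun x => Num.max (f x) (g x)).
Proof. by move=> cf cg x; apply: (@continuous_max _ _ f g); [exact: cf|exact: cg]. Qed.

Lemma continuous_minr f g : continuous f -> continuous g ->
  continuous (fun x => Num.min (f x) (g x)).
Proof. by move=> cf cg x; apply: (@continuous_min _ _ f g); [exact: cf|exact: cg]. Qed.

Lemma continuous_mulr f g : continuous f -> continuous g ->
  continuous (fun x => f x * g x).
Proof. by move=> cf cg x; apply: cvgM; [exact: cf|exact: cg]. Qed.

Lemma continuous_subr f g : continuous f -> continuous g ->
  continuous (fun x => f x - g x).
Proof. by move=> cf cg x; apply: cvgB; [exact: cf|exact: cg]. Qed.

Lemma continuous_cstr (c : R) : continuous (fun _ : X => c).
Proof. by move=> x; exact: cvg_cst. Qed.

End pointwise_continuity.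

(** * Rademacher's theorem *)

Section density_measure.
Context {d} {T : measurableType d} {R : realType}.
Variables (mu : {measure set T -> \bar R}) (g : T -> R).
Hypotheses (mg : measurable_fun setT g) (g0 : forall x, 0 <= g x).

(* The dummy let makes the hypotheses arguments of the definition, so that the
   measure structure can be attached to it. *)
Definition density_measure (A : set T) : \bar R :=
  let _ := (mg, g0) in (\int[mu]_(x in A) (g x)%:E)%E.

Let dm0 : density_measure set0 = 0%E.
Proof. by rewrite /density_measure integral_set0. Qed.

Let dm_ge0 A : (0 <= density_measure A)%E.
Proof. by rewrite /density_measure integral_ge0// => x _; rewrite lee_fin. Qed.

Let dm_sigma_additive : semi_sigma_additive density_measure.
Proof.
move=> F mF tF mUF; rewrite /density_measure ge0_integral_bigcup//=; last 2 first.
- by apply/measurable_EFinP; exact: measurable_funTS.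
- by move=> x _; rewrite lee_fin.
apply: is_cvg_ereal_nneg_natsum_cond => n _ _.
by rewrite integral_ge0// => x _; rewrite lee_fin.
Qed.

HB.instance Definition _ := isMeasure.Build _ _ _
  density_measure dm0 dm_ge0 dm_sigma_additive.

End density_measure.

(** * Test functions and the Borel sets they determine *)

Section test_functions.
Context {R : realType} {n : nat}.
Notation lam := (@lebesgue_rV R n).

Lemma lebesgue_rV_ball_lty (K : R) :
  (lam [set x : 'rV[R]_n | (`|x| < K)%R] < +oo)%E.
Proof.
pose B := [set x : 'rV[R]_n | forall i, `]- K, K[%classic (x ord0 i)].
have mB : measurable B.
  exact: (measurable_rV_box (fun i => measurable_itv `]- K, K[)).
apply: (@le_lt_trans _ _ (lam B)).
  apply: le_measure; rewrite ?inE//.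
    have := @measurable_rV_ball R n 0 K.
    by under eq_set do rewrite subr0.
  move=> x /= xK i; rewrite /= in_itv/= -ltr_norml.
  exact: le_lt_trans (coord_le_norm _ _) xK.
rewrite -ge0_fin_numE// /B (lebesgue_rV_box (fun i => measurable_itv `]- K, K[)).
apply: (big_ind (fun a : \bar R => a \is a fin_num)) => //.
  by move=> a b; exact: fin_numM.
by move=> i _; rewrite lebesgue_measure_itv/=; case: ifP.
Qed.

Definition compact_supp (phi : 'rV[R]_n -> R) :=
  exists K, forall x, K <= `|x| -> phi x = 0.

(* A pi-system generating the Borel sets whose indicators are increasing limits
   min(1, j d) of test functions. *)
Definition test_sets : set (set 'rV[R]_n) :=
  [set A | exists d : 'rV[R]_n -> R, [/\ continuous d, forall x, 0 <= d x,
     compact_supp d & A = [set x | 0 < d x]]].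

Lemma test_sets_measurable : test_sets `<=` measurable.
Proof.
move=> _ [d [cd _ _ ->]]; apply: open_measurable_rV.
rewrite (_ : mkset _ = d @^-1` `]0, +oo[).
  by move/continuousP : cd; apply; exact: interval_open.
by apply/seteqP; split => x /=; rewrite in_itv/= andbT.
Qed.

Lemma test_setsI : setI_closed test_sets.
Proof.
move=> _ _ [d [cd d0 [K dK] ->]] [e [ce e0 _ ->]].
exists (d \* e); split => [x|x||].
- by move: x; exact: continuous_mulr.
- by rewrite mulr_ge0.
- by exists K => x xK /=; rewrite dK// mul0r.
apply/seteqP; split => x /=; first by move=> [? ?]; rewrite mulr_gt0.
move=> de; split; rewrite lt_neqAle ?d0 ?e0 andbT eq_sym.
  by apply: contraTneq de => ->; rewrite mul0r ltxx.
by apply: contraTneq de => ->; rewrite mulr0 ltxx.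
Qed.

Let tent (N : R) (x : 'rV[R]_n) : R := Num.max 0 (N - `|x|).

Let tent_continuous N : continuous (tent N).
Proof.
apply: continuous_maxr; first exact: continuous_cstr.
by apply: continuous_subr; [exact: continuous_cstr|exact: norm_continuous].
Qed.

Let tent_gt0 N x : (0 < tent N x) = (`|x| < N).
Proof. by rewrite /tent lt_max ltxx/= subr_gt0. Qed.

Let tent_ge0 N x : 0 <= tent N x.
Proof. by rewrite /tent le_max lexx. Qed.

Let tent_supp N : compact_supp (tent N).
Proof. by exists N => x Nx; rewrite /tent max_l// subr_le0. Qed.

Lemma ball_test_set (N : R) : test_sets [set x | `|x| < N].
Proof.
exists (tent N); split => //.
by apply/seteqP; split => x /=; rewrite tent_gt0.
Qed.

Lemma bigcup_ball_nat : \bigcup_(k : nat) [set x : 'rV[R]_n | `|x| < k%:R] = setT.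
Proof.
apply/seteqP; split => // x _; exists (Num.bound `|x|) => //=.
by rewrite archi_boundP.
Qed.

(** It suffices that each coordinate is measurable for the sigma-algebra generated by [test_sets];
    [T'] is the same space carrying that sigma-algebra. *)
Lemma test_sets_generate : (measurable : set (set 'rV[R]_n)) = <<s test_sets >>.
Proof.
apply/seteqP; split; last first.
  by apply: smallest_sub; [exact: sigma_algebra_measurable|exact: test_sets_measurable].
pose T' := g_sigma_algebraType test_sets.
apply: smallest_sub; first exact: smallest_sigma_algebra.
rewrite -bigcup_seq => A [i _ [B mB <-]].
suff mc : measurable_fun (setT : set T') (fun x : T' => (x : 'rV[R]_n) ord0 i).
  exact: mc.
apply: (measurability _ (RGenOpens.measurableE R)).
move=> _ [_ [a [b ->] <-]]; rewrite setTI.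
(* [D N] is positive exactly where a < x_i < b and |x| < N; the tent factor supplies the compact
   support. *)
pose D N (x : 'rV[R]_n) : R :=
  Num.max 0 (Num.min (x ord0 i - a) (b - x ord0 i)) * tent N%:R x.
rewrite (_ : _ @^-1` _ = \bigcup_N [set x | 0 < D N x]).
  apply: (@bigcup_measurable _ T') => N _; apply: sub_sigma_algebra.
  exists (D N); split => //.
  - apply: continuous_mulr; last exact: tent_continuous.
    apply: continuous_maxr; first exact: continuous_cstr.
    apply: continuous_minr.
      by apply: continuous_subr; [exact: coord_continuous|exact: continuous_cstr].
    by apply: continuous_subr; [exact: continuous_cstr|exact: coord_continuous].
  - by move=> x; rewrite mulr_ge0// le_max lexx.
  - by have [K tK] := tent_supp N%:R; exists K => x Kx; rewrite /D tK// mulr0.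
apply/seteqP; split => x /=.
  rewrite in_itv/= => /andP[ax xb].
  exists (Num.bound `|x|) => //=; rewrite mulr_gt0// ?tent_gt0 ?archi_boundP//.
  by rewrite lt_max lt_min !subr_gt0 ax xb orbT.
move=> [N _ /= DN]; have : 0 < Num.max 0 (Num.min (x ord0 i - a) (b - x ord0 i)).
  rewrite lt_neqAle le_max lexx andbT eq_sym; apply: contraTneq DN => H.
  by rewrite /D H mul0r ltxx.
by rewrite lt_max ltxx/= lt_min !subr_gt0 in_itv/=.
Qed.

End test_functions.

Lemma dominated_convergence_EFin d (T : measurableType d) (R : realType)
    (mu : {measure set T -> \bar R}) (f_ : nat -> T -> R) (f g : T -> R) :
  (forall m, measurable_fun setT (f_ m)) -> measurable_fun setT f ->
  {ae mu, forall x, f_ m x @[m --> \oo] --> f x} ->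
  mu.-integrable setT (EFin \o g) ->
  {ae mu, forall x, forall m, `|f_ m x| <= g x} ->
  mu.-integrable setT (EFin \o f) /\
  (\int[mu]_x (f_ m x)%:E @[m --> \oo] --> \int[mu]_x (f x)%:E)%E.
Proof.
move=> mf_ mf f_f ig f_g.
have [] := @dominated_convergence _ T R mu setT measurableT
  (fun m x => (f_ m x)%:E) (EFin \o f) (EFin \o g).
- by move=> m; exact/measurable_EFinP.
- exact/measurable_EFinP.
- by move/ae_imp : f_f; apply => x fx _; apply: cvg_EFin => //; exact: nearW.
- exact: ig.
- by move/ae_imp : f_g; apply => x gx m _; rewrite /= lee_fin.
by [].
Qed.

Section compactly_supported.
Context {R : realType} {n : nat}.
Notation lam := (@lebesgue_rV R n).

Lemma compact_supp_integrable (g : 'rV[R]_n -> R) (B : R) :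
  measurable_fun setT g -> (forall x, `|g x| <= B) -> compact_supp g ->
  lam.-integrable setT (EFin \o g).
Proof.
move=> mg gB [K gK]; pose A := [set x : 'rV[R]_n | `|x| < K].
have mA : measurable A by apply: test_sets_measurable; exact: ball_test_set.
have -> : g = g \_ A.
  apply/funext => x; rewrite patchE; case: ifPn => // /negP xA.
  by rewrite gK// leNgt; apply/negP => xK; apply: xA; rewrite inE.
rewrite -restrict_EFin; apply/(integrable_mkcond (EFin \o g) mA).
apply: measurable_bounded_integrable => //.
- exact: lebesgue_rV_ball_lty.
- exact: measurable_funTS.
exists B; split; first exact: num_real.
by move=> M BM x _ /=; rewrite (le_trans (gB x))// ltW.
Qed.

(** Adding the bound [c] makes [W + c] nonnegative, hence the density of a measure. This measure
    agrees with the one of constant density [c] on the pi-system of test sets, so everywhere, and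
    the two densities are equal almost everywhere. *)
Lemma ae_eq0_test (W : 'rV[R]_n -> R) (c : R) :
  measurable_fun setT W -> (forall x, `|W x| <= c) ->
  (forall phi : 'rV[R]_n -> R, continuous phi -> (forall x, `|phi x| <= 1) ->
    compact_supp phi -> (\int[lam]_x (phi x * W x)%:E = 0)%E) ->
  {ae lam, forall x, W x = 0}.
Proof.
move=> mW Wc Wphi.
have mWc : measurable_fun setT (fun x => W x + c) by apply: measurable_funD.
have Wc0 x : 0 <= W x + c.
  by have := Wc x; rewrite ler_norml => /andP[]; rewrite -subr_ge0 opprK.
have c0 (x : 'rV[R]_n) : 0 <= (cst c : 'rV[R]_n -> R) x.
  by rewrite /= (le_trans (normr_ge0 _) (Wc x)).
have mc : measurable_fun setT (cst c : 'rV[R]_n -> R) by [].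
(* The test functions min(1, j d) tend to the indicator of {d > 0} and are supported in one ball, on
   which the constant [c] dominates. *)
have W_test A : test_sets A -> (\int[lam]_(x in A) (W x)%:E = 0)%E.
  move=> [d [cd d0 [K dK] AE]].
  pose phi (j : nat) x := Num.min 1 (j%:R * d x).
  have cphi j : continuous (phi j).
    by apply: continuous_minr; [exact: continuous_cstr|
      apply: continuous_mulr => //; exact: continuous_cstr].
  have phi_ge0 j x : 0 <= phi j x by rewrite /phi le_min ler01 mulr_ge0.
  have phi1 j x : `|phi j x| <= 1 by rewrite ger0_norm// /phi ge_min lexx.
  have phiK j x : K <= `|x| -> phi j x = 0.
    by move=> Kx; rewrite /phi dK// mulr0 min_r.
  have mA : measurable A.
    by apply: test_sets_measurable; exists d; split => //; exists K.
  rewrite integral_mkcond restrict_EFin.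
  have [|||||_ H] := @dominated_convergence_EFin _ _ _ lam
    (fun j x => phi j x * W x) (W \_ A) (fun x => c * \1_[set x : 'rV[R]_n | `|x| < K] x).
  - by move=> j; apply: measurable_funM => //; exact: continuous_measurable_rV.
  - by apply/(measurable_restrictT _ _).1 => //; exact: measurable_funTS.
  - apply: aeW => x; rewrite patchE; case: ifPn => [|/negP]; rewrite inE AE /= => dx.
      apply: cvg_near_cst; exists (Num.bound (d x)^-1) => // j /= jd.
      rewrite /phi min_l ?mul1r// -ler_pdivrMr// mul1r.
      rewrite (le_trans (ltW (archi_boundP _)))// ?ler_nat// invr_ge0 ltW//.
    have d0x : d x = 0 by apply/eqP; rewrite eq_le d0 leNgt andbT; apply/negP.
    by apply: cvg_near_cst; apply: nearW => j; rewrite /phi d0x mulr0 min_r ?mul0r.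
  - apply: (@compact_supp_integrable _ c).
    + apply: measurable_funM => //; apply: measurable_indic.
      by apply: test_sets_measurable; exact: ball_test_set.
    + move=> x; rewrite indicE; case: (_ \in _); rewrite ?mulr1 ?mulr0 ?normr0//.
        by rewrite ger0_norm// (c0 x).
      exact: (c0 x).
    + by exists K => x Kx; rewrite indicE memNset ?mulr0//= ltNge Kx.
  - apply: aeW => x j; have [xK|xK] := ltP `|x| K.
      by rewrite indicE mem_set//= mulr1 normrM (le_trans _ (Wc x))// ler_piMl.
    by rewrite phiK// mul0r normr0 mulr_ge0 ?(c0 x).
  apply/esym; apply: cvg_unique H => //.
  apply: cvg_near_cst; apply: nearW => j; apply: Wphi => //.
  by exists K => x; exact: phiK.
have int_ball k (g : 'rV[R]_n -> R) b : measurable_fun setT g ->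
    (forall x, `|g x| <= b) ->
    forall E : set 'rV[R]_n, measurable E -> E `<=` [set x : 'rV[R]_n | `|x| < k] ->
    lam.-integrable E (EFin \o g).
  move=> mg gb E mE Ek; apply: measurable_bounded_integrable => //.
  - apply: le_lt_trans (lebesgue_rV_ball_lty k); apply: le_measure => //; rewrite inE//.
    by apply: test_sets_measurable; exact: ball_test_set.
  - exact: measurable_funTS.
  exists b; split; first exact: num_real.
  by move=> M bM x _ /=; rewrite (le_trans (gb x))// ltW.
have cb : forall x : 'rV[R]_n, `|cst c x| <= c by move=> x; rewrite ger0_norm// (c0 x).
have Wcb x : `|W x + c| <= c + c.
  by rewrite (le_trans (ler_normD _ _))// lerD// ger0_norm// (c0 x).
have eqm A : measurable A -> density_measure lam mWc Wc0 A = density_measure lam mc c0 A.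
  apply: (measure_unique test_sets (fun k : nat => [set x : 'rV[R]_n | `|x| < k%:R])).
  - exact: test_sets_generate.
  - exact: test_setsI.
  - by move=> k; exact: ball_test_set.
  - exact: bigcup_ball_nat.
  - move=> B tB; rewrite /= /density_measure.
    have mB := test_sets_measurable tB.
    have [K BK] : exists K, B `<=` [set x : 'rV[R]_n | `|x| < K].
      move: tB => [d [_ _ [K dK] ->]]; exists K => x /= dx.
      by rewrite ltNge; apply/negP => /dK d0; move: dx; rewrite d0 ltxx.
    under eq_integral do rewrite EFinD.
    rewrite integralD_EFin//; [|exact: int_ball BK|exact: int_ball BK].
    by rewrite W_test// add0e.
  - move=> k; rewrite /= /density_measure.
    have mk := test_sets_measurable (@ball_test_set R n k%:R).
    apply: (integrable_lty mk); exact: (int_ball k%:R _ _ mWc Wcb).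
(* Densities are compared ball by ball, since a nonzero constant is integrable over a ball but in
   general not over the whole space. *)
have : {ae lam, forall x (k : nat), `|x| < k%:R -> (W x + c)%:E = c%:E}.
  apply/ae_foralln => k.
  have mk : measurable [set x : 'rV[R]_n | `|x| < k%:R].
    by apply: test_sets_measurable; exact: ball_test_set.
  apply: (@integral_ae_eq _ _ _ lam _ mk (EFin \o cst c) (EFin \o (fun x => W x + c))).
  - exact: (int_ball k%:R _ _ mWc Wcb).
  - by apply/measurable_EFinP.
  - by move=> E Ek mE; exact: eqm.
move/ae_imp; apply => x /(_ (Num.bound `|x|)) /(_ (archi_boundP (normr_ge0 _))).
by move=> [] /eqP; rewrite -subr_eq0 addrK => /eqP.
Qed.

End compactly_supported.

(** * Almost everywhere linearity in the direction, and total differentiability *)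

Section rademacher.
Context {R : realType} {n : nat}.
Notation lam := (@lebesgue_rV R n).
Implicit Types (f : 'rV[R]_n -> R) (u v x : 'rV[R]_n).

Lemma dist_le_line f M v x (h : R) :
  (forall x y, `|f x - f y| <= M * `|x - y|) ->
  `|f (h *: v + x) - f x| <= (M * `|v|) * `|h|.
Proof. by move=> /(_ (h *: v + x) x); rewrite addrK normrZ mulrAC -mulrA. Qed.

(** The weights [a m] may vary with m so that the statement covers both a fixed test function and
    one translated by a vector tending to 0. *)
Lemma cvg_integral_dquot f M v (a : nat -> 'rV[R]_n -> R) (phi : 'rV[R]_n -> R) K :
  (forall x y, `|f x - f y| <= M * `|x - y|) ->
  (forall m, measurable_fun setT (a m)) -> measurable_fun setT phi ->
  (forall m x, `|a m x| <= 1) -> (forall m x, K <= `|x| -> a m x = 0) ->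
  (forall x, a m x @[m --> \oo] --> phi x) ->
  (\int[lam]_x (a m x * dquot f v m x)%:E @[m --> \oo]
    --> \int[lam]_x (phi x * 'D_v f x)%:E)%E.
Proof.
move=> fM ma mphi a1 aK a_phi.
have cf := dist_le_continuous fM.
have C0 : 0 <= M * `|v|.
  by have := dist_le_line v 0 1 fM; rewrite normr1 mulr1; exact: le_trans.
have [|||||_ //] := @dominated_convergence_EFin _ _ _ lam
  (fun m x => a m x * dquot f v m x) (fun x => phi x * 'D_v f x)
  (fun x => (M * `|v|) * \1_[set x : 'rV[R]_n | `|x| < K] x).
- by move=> m; apply: measurable_funM => //; exact: measurable_dquot.
- by apply: measurable_funM => //; exact: measurable_derive.
- apply: (ae_imp (lipschitz_ae_derivable_rV v fM)) => x dx.
  by apply: cvgM => //; exact: cvg_dquot.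
- apply: (@compact_supp_integrable _ _ _ (M * `|v|)).
  + apply: measurable_funM => //; apply: measurable_indic.
    by apply: test_sets_measurable; exact: ball_test_set.
  + move=> x; rewrite indicE; case: (_ \in _); rewrite ?mulr1 ?mulr0 ?normr0//.
    by rewrite ger0_norm.
  + by exists K => x Kx; rewrite indicE memNset ?mulr0//= ltNge Kx.
- apply: aeW => x m; have [xK|xK] := ltP `|x| K.
    rewrite indicE mem_set//= mulr1 normrM -[leRHS]mul1r ler_pM//.
    by apply: dquot_le => h; exact: dist_le_line.
  by rewrite aK// mul0r normr0 mulr_ge0.
Qed.

(* Tested against phi, the quotient along u + v splits into the one along u and
   the one along v at x + h u; translating the latter by h u moves the shift
   onto phi, where it disappears in the limit by continuity. *)
Lemma derive_addv_ae f M u v :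
  (forall x y, `|f x - f y| <= M * `|x - y|) ->
  {ae lam, forall x, 'D_(u + v) f x = 'D_u f x + 'D_v f x}.
Proof.
move=> fM; have cf := dist_le_continuous fM.
have Cq w m x : `|dquot f w m x| <= M * `|w|.
  by apply: dquot_le => h; exact: dist_le_line.
have CD w x : `|'D_w f x| <= M * `|w|.
  by apply: derive_le => h; exact: dist_le_line.
have mD w := measurable_derive w cf.
suff : {ae lam, forall x, 'D_(u + v) f x - ('D_u f x + 'D_v f x) = 0}.
  by move/ae_imp; apply => x /eqP; rewrite subr_eq0 => /eqP.
apply: (@ae_eq0_test _ _ _ (M * `|u + v| + (M * `|u| + M * `|v|))).
- by apply: measurable_funB => //; exact: measurable_funD.
- move=> x; rewrite (le_trans (ler_normB _ _))// lerD//.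
  by rewrite (le_trans (ler_normD _ _))// lerD.
move=> phi cphi phi1 [K phiK].
have mphi : measurable_fun setT phi by exact: continuous_measurable_rV.
have iphi (g : 'rV[R]_n -> R) B : measurable_fun setT g -> (forall x, `|g x| <= B) ->
    lam.-integrable setT (EFin \o (fun x => phi x * g x)).
  move=> mg gB; apply: (@compact_supp_integrable _ _ _ B).
  - exact: measurable_funM.
  - by move=> x; rewrite normrM -[leRHS]mul1r ler_pM.
  - by exists K => x Kx; rewrite phiK// mul0r.
have lim_phi w : (\int[lam]_x (phi x * dquot f w m x)%:E @[m --> \oo]
    --> \int[lam]_x (phi x * 'D_w f x)%:E)%E.
  apply: (@cvg_integral_dquot f M w (fun=> phi) phi K) => //.
  by move=> x; exact: cvg_cst.
pose a m x := phi (m.+1%:R^-1 *: - u + x).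
have lim_a : (\int[lam]_x (a m x * dquot f v m x)%:E @[m --> \oo]
    --> \int[lam]_x (phi x * 'D_v f x)%:E)%E.
  apply: (@cvg_integral_dquot f M v a phi (K + `|u|)) => //.
  - move=> m; apply: continuous_measurable_rV => x; apply: continuous_comp; last exact: cphi.
    exact: continuous_rV_translate.
  - move=> m x; exact: phi1.
  - move=> m x Kx; apply: phiK; rewrite scalerN addrC.
    have := lerB_dist x (m.+1%:R^-1 *: u); apply: le_trans.
    rewrite normrZ lerBrDr (le_trans _ Kx)// lerD2l ler_piMl//.
    by rewrite ger0_norm// invf_le1// ler1n.
  - move=> x; rewrite /a.
    have cl : {for 0, continuous (fun h : R => phi (h *: - u + x))}.
      by apply: continuous_comp; [exact: continuous_rV_line|exact: cphi].
    have := cvg_comp _ _ (@cvg_harmonic R) cl.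
    by rewrite /= scale0r add0r.
have split_eq m : (\int[lam]_x (phi x * dquot f (u + v) m x)%:E =
    \int[lam]_x (phi x * dquot f u m x)%:E + \int[lam]_x (a m x * dquot f v m x)%:E)%E.
  have mq w := measurable_dquot w m cf.
  rewrite -(integral_shift (m.+1%:R^-1 *: u)
    (f := fun x => (a m x * dquot f v m x)%:E)); last first.
    apply/measurable_EFinP; apply: measurable_funM => //.
    apply: continuous_measurable_rV => x; apply: continuous_comp; last exact: cphi.
    exact: continuous_rV_translate.
  rewrite /a; under [X in (_ + X)%E]eq_integral do rewrite scalerN [- _ + _]addrC addrK.
  rewrite -integralD_EFin//; first last.
  - apply: iphi (fun x => Cq v m (x + m.+1%:R^-1 *: u)).
    exact: (measurableT_comp (mq v) (measurable_rV_shift _)).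
  - exact: iphi (Cq u m).
  apply: eq_integral => x _; rewrite /= -EFinD; congr (_%:E).
  rewrite /dquot scalerDr; set hu := _ *: u; set hv := _ *: v.
  rewrite (_ : hu + hv + x = hv + (x + hu)); last by rewrite addrC addrA addrC addrA.
  rewrite [x + hu]addrC; ring.
have fin_lim w : (\int[lam]_x (phi x * 'D_w f x)%:E)%E \is a fin_num.
  by apply: integrable_fin_num => //; exact: iphi (CD w).
have lim_eq : (\int[lam]_x (phi x * 'D_(u + v) f x)%:E =
    \int[lam]_x (phi x * 'D_u f x)%:E + \int[lam]_x (phi x * 'D_v f x)%:E)%E.
  have defuv := fin_num_adde_defl (\int[lam]_x (phi x * 'D_u f x)%:E)%E (fin_lim v).
  have limD := cvgeD defuv (lim_phi u) lim_a.
  have limD' : (\int[lam]_x (phi x * dquot f (u + v) m x)%:E @[m --> \oo] -->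
      \int[lam]_x (phi x * 'D_u f x)%:E + \int[lam]_x (phi x * 'D_v f x)%:E)%E.
    by rewrite (eq_cvg _ _ split_eq); exact: limD.
  exact: (cvg_unique _ (lim_phi (u + v)) limD').
under eq_integral do rewrite mulrBr mulrDr EFinB.
rewrite integralB_EFin//; first last.
- under eq_fun do rewrite -mulrDr.
  apply: (iphi _ (M * `|u| + M * `|v|)); first exact: measurable_funD.
  by move=> x; rewrite (le_trans (ler_normD _ _))// lerD.
- exact: iphi (CD (u + v)).
under [X in (_ - X)%E]eq_integral do rewrite EFinD.
rewrite integralD_EFin//; [|exact: iphi (CD u)|exact: iphi (CD v)].
rewrite lim_eq subee// fin_numD.
by apply/andP; split; exact: fin_lim.
Qed.


Lemma derive_line0 f x v : 'D_1 (fun h : R => f (h *: v + x)) 0 = 'D_v f x.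
Proof.
by rewrite derive_lineE scale0r add0r.
Qed.

Lemma derivable_scalev f c v x : derivable f x v ->
  derivable f x (c *: v) /\ 'D_(c *: v) f x = c * 'D_v f x.
Proof.
move=> dx; pose F h := f (h *: v + x).
have dF : is_derive (c * 0) 1 F ('D_v f x).
  by rewrite mulr0; split; [exact: (derivable1P f x v).1|exact: derive_line0].
have dc : is_derive (0 : R) (1 : R) ( *%R c) c.
  have -> : *%R c = c \*: (@id R) by [].
  split; first by apply: derivableZ; exact: derivable_id.
  by rewrite deriveZ ?derive_id ?[_%:A]mulr1//; exact: derivable_id.
have [dd De] := is_derive1_comp dF dc.
have lineE : (fun h : R => f (h *: (c *: v) + x)) = F \o ( *%R c).
  by apply/funext => h; rewrite /F /= scalerA mulrC.
split; first by apply/(derivable1P f x (c *: v)).2; rewrite lineE.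
by rewrite -derive_line0 lineE De mulrC.
Qed.

Lemma dotvDr (a u v : 'rV[R]_n) : dotv a (u + v) = dotv a u + dotv a v.
Proof.
by rewrite /dotv -big_split; apply: eq_bigr => i _; rewrite mxE mulrDr.
Qed.

Lemma dotvZr (a v : 'rV[R]_n) c : dotv a (c *: v) = c * dotv a v.
Proof.
by rewrite /dotv big_distrr; apply: eq_bigr => i _; rewrite /= mxE mulrCA.
Qed.

Lemma dotvBr (a u v : 'rV[R]_n) : dotv a (u - v) = dotv a u - dotv a v.
Proof. by rewrite -[- v]scaleN1r dotvDr dotvZr mulN1r. Qed.

Lemma dotv_delta (a : 'rV[R]_n) i : dotv a (delta_mx ord0 i) = a ord0 i.
Proof.
rewrite /dotv (bigD1 i)//= mxE !eqxx mulr1 big1 ?addr0// => j ji.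
by rewrite mxE (negbTE ji) andbF mulr0.
Qed.

(** Induction over the expansion of [v] in the standard basis: almost everywhere additivity handles
    sums, homogeneity the multiples of basis vectors. The exceptional null set depends on [v], so
    only countably many directions can be treated at once. *)
Lemma derive_grad_ae f M v :
  (forall x y, `|f x - f y| <= M * `|x - y|) ->
  {ae lam, forall x, derivable f x v /\ 'D_v f x = dotv (grad f x) v}.
Proof.
move=> fM; rewrite (row_sum_delta v).
apply: (@big_ind _ (fun w =>
  {ae lam, forall x, derivable f x w /\ 'D_w f x = dotv (grad f x) w})).
- apply: aeW => x; have d0 : derivable f x 0 by exact: derivable0.
  split=> //.
  rewrite -[X in 'D_X _ _](scale0r (0 : 'rV[R]_n)).
  have [_ ->] := derivable_scalev 0 d0.
  by rewrite -[in RHS](scale0r (0 : 'rV[R]_n)) dotvZr !mul0r.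
- move=> u w Pu Pw.
  have Puw := ae_and (derive_addv_ae u w fM) (lipschitz_ae_derivable_rV (u + w) fM).
  apply: (ae_imp (ae_and (ae_and Pu Pw) Puw)) => x [[[du Du] [dw Dw]] [Duw duw]].
  by split => //; rewrite Duw Du Dw dotvDr.
- move=> i _.
  apply: (ae_imp (lipschitz_ae_derivable_rV (delta_mx ord0 i) fM)) => x dx.
  have [? ->] := derivable_scalev (v ord0 i) dx.
  by split => //; rewrite dotvZr dotv_delta mxE.
Qed.

Lemma dotv_le (a u : 'rV[R]_n) : `|dotv a u| <= (\sum_i `|a ord0 i|) * `|u|.
Proof.
rewrite /dotv (le_trans (ler_norm_sum _ _ _))// big_distrl/= ler_sum// => i _.
by rewrite normrM ler_wpM2l// coord_le_norm.
Qed.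

(** The Lipschitz bounds on [f] and on the linear form [dotv a] transfer convergence from rational
    directions to nearby ones, and compactness of the unit ball makes it uniform in the direction,
    which is total differentiability. *)
Lemma dist_le_differentiable f M x (a : 'rV[R]_n) :
  (forall x y, `|f x - f y| <= M * `|x - y|) ->
  (forall q : 'rV[rat]_n, derivable f x (map_mx ratr q) /\
     'D_(map_mx ratr q) f x = dotv a (map_mx ratr q)) ->
  differentiable f x.
Proof.
move=> fM fq.
pose S : set 'rV[R]_n := [set w | `|w| <= 1].
have cS : compact S by exact: compact_norm_le.
pose G : R := \sum_i `|a ord0 i|.
have G0 : 0 <= G by exact: sumr_ge0.
have unif e : 0 < e -> \forall h \near (0 : R), forall w, `|w| <= 1 ->
    `|f (h *: w + x) - f x - h * dotv a w| <= e * `|h|.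
  move=> e0.
  pose P (h : R) (w : 'rV[R]_n) := `|f (h *: w + x) - f x - h * dotv a w| <= e * `|h|.
  (* By compactness it is enough to find, for each direction w, neighbourhoods of w and of 0 on
     which the estimate holds. *)
  have /compact_near_coveringP/(_ R (nbhs (0 : R)) P) := cS.
  apply => w _.
  pose M' := `|M| + 1.
  have M'0 : 0 < M' by rewrite ltr_wpDl.
  have fM' y z : `|f y - f z| <= M' * `|y - z|.
    by rewrite (le_trans (fM _ _))// ler_wpM2r// (le_trans (ler_norm _))// lerDl.
  have MG : 0 < 4 * (M' + G) by rewrite mulr_gt0// ltr_pwDl.
  (* Replacing w' by the rational vector v, at distance below 2 eta, costs 2 eta M' |h| for [f] and
     2 eta G |h| for the linear form, together e/2 |h|; the other half comes from the derivative
     along v. *)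
  pose eta := e / (4 * (M' + G)).
  have eta0 : 0 < eta by rewrite divr_gt0.
  have [q qw] := dense_rat_rV w eta0.
  pose v : 'rV[R]_n := map_mx ratr q.
  have [dv Dv] := fq q.
  have near_v : \forall h \near (0 : R),
      `|f (h *: v + x) - f x - h * dotv a v| <= (e / 2) * `|h|.
    have : (fun h => h^-1 * (f (h *: v + x) - f x)) h @[h --> 0^'] --> dotv a v.
      by rewrite -Dv; exact: dv.
    move/cvgrPdist_le => /(_ (e / 2) (divr_gt0 e0 (ltr0Sn R 1))).
    move=> lim_v; have {lim_v} : \forall h \near (0 : R), h != 0 ->
        `|dotv a v - h^-1 * (f (h *: v + x) - f x)| <= e / 2 by exact: lim_v.
    apply: filterS => h hP.
    have [->|h0] := eqVneq h 0.
      by rewrite scale0r add0r subrr mul0r subr0 normr0 mulr0.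
    rewrite -ler_pdivrMr ?normr_gt0// -normrV ?unitfE// -normrM.
    by move: (hP h0); rewrite distrC mulrBl (mulrC h) mulfK// (mulrC _ h^-1).
  have near_w : \forall w' \near w, `|w' - v| < 2 * eta.
    apply: near_dist_lt; rewrite (lt_trans qw)//; lra.
  exists ([set w' | `|w' - v| < 2 * eta],
          [set h | `|f (h *: v + x) - f x - h * dotv a v| <= (e / 2) * `|h|]) => //.
  move=> [w' h] /= [ww' hv]; rewrite /P.
  rewrite (_ : _ - _ - _ = (f (h *: w' + x) - f (h *: v + x)) +
    (f (h *: v + x) - f x - h * dotv a v) + h * (dotv a v - dotv a w')); last by ring.
  have H1 : `|f (h *: w' + x) - f (h *: v + x)| <= (M' * (2 * eta)) * `|h|.
    rewrite (le_trans (fM' _ _))// opprD addrACA subrr addr0 -scalerBr normrZ.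
    by rewrite mulrCA (mulrC `|h|) ler_wpM2r// ler_wpM2l// ltW.
  have H2 : `|h * (dotv a v - dotv a w')| <= (G * (2 * eta)) * `|h|.
    rewrite normrM mulrC ler_wpM2r// -dotvBr.
    by rewrite (le_trans (dotv_le _ _))// ler_wpM2l// distrC ltW.
  rewrite (le_trans (ler_normD _ _))//.
  rewrite (le_trans (lerD (ler_normD _ _) H2))//.
  rewrite (le_trans (lerD (lerD H1 hv) (lexx _)))// -!mulrDl ler_wpM2r//.
  rewrite (_ : _ + _ = (4 * (M' + G)) * eta / 2 + e / 2); last by field.
  rewrite /eta mulrCA divff ?gt_eqF// mulr1; lra.
have lin_a : linear (dotv a).
  by move=> c u w; rewrite dotvDr dotvZr.
pose df_mixin := GRing.isLinear.Build R 'rV[R]_n R *%R (dotv a) lin_a.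
pose df : {linear 'rV[R]_n -> R} := HB.pack (dotv a) df_mixin.
have cdf : continuous df.
  apply: (@dist_le_continuous _ _ _ _ G) => u w /=.
  by rewrite -dotvBr dotv_le.
have dfE : f \o shift x = cst (f x) + df +o_ (0 : 'rV[R]_n) id.
  apply/eqaddoP => e e0.
  have /nbhs_ballP[d /= d0 dP] := unif e e0.
  apply/nbhs_ballP; exists d => //= y; rewrite -ball_normE/= sub0r normrN => yd.
  have [->|y0] := eqVneq y 0.
    rewrite !fctE /= add0r (_ : dotv a 0 = 0) ?addr0 ?subrr ?normr0 ?mulr0//.
    by rewrite /dotv big1// => i _; rewrite mxE mulr0.
  have yn0 : `|y| != 0 by rewrite normr_eq0.
  have := dP `|y|; rewrite -ball_normE/= sub0r normrN normr_id => /(_ yd (`|y|^-1 *: y)).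
  rewrite normrZ ger0_norm ?invr_ge0// mulVf// lexx => /(_ isT).
  rewrite scalerA divff// scale1r dotvZr mulrA divff// mul1r.
  by rewrite !fctE /= opprD addrA.
apply/diff_locallyP; rewrite (diff_unique cdf dfE).
by split.
Qed.

Lemma rademacher f M :
  (forall x y, `|f x - f y| <= M * `|x - y|) ->
  {ae lam, forall x, differentiable f x}.
Proof.
move=> fM.
have : {ae lam, forall x (q : 'rV[rat]_n), derivable f x (map_mx ratr q) /\
    'D_(map_mx ratr q) f x = dotv (grad f x) (map_mx ratr q)}.
  by apply: ae_forall_countable => q; exact: derive_grad_ae fM.
by move/ae_imp; apply => x fq; exact: dist_le_differentiable fM fq.
Qed.

Lemma rademacher_rV m (f : 'rV[R]_n -> 'rV[R]_m) M :
  (forall x y, `|f x - f y| <= M * `|x - y|) ->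
  {ae lam, forall x, differentiable f x}.
Proof.
move=> fM.
have : {ae lam, forall x (i : 'I_m), differentiable (fun y => f y ord0 i) x}.
  apply: ae_forall_countable => i; apply: (@rademacher _ M) => x y.
  apply: le_trans (fM x y).
  by have := coord_le_norm (f x - f y) i; rewrite !mxE.
move/ae_imp; apply => x fi.
rewrite (_ : f = \sum_(i < m) (fun y => f y ord0 i *: delta_mx ord0 i)).
  by apply: differentiable_sum => i; apply: differentiableZl.
by apply/funext => y; rewrite [LHS]row_sum_delta fct_sumE.
Qed.

End rademacher.

(** * Integration by parts *)

Section locally_dist_le_theory.
Context {R : realType} {V : normedModType R}.
Implicit Types f g : V -> R.

Lemma dist_le_locally f M :
  (forall x y, `|f x - f y| <= M * `|x - y|) -> locally_dist_le f.
Proof. by move=> fM x; exists M, 1; split => // y z _ _; exact: fM. Qed.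

Lemma locally_dist_leM f g : locally_dist_le f -> locally_dist_le g ->
  locally_dist_le (f \* g).
Proof.
move=> fl gl x; have [M [r [r0 fM]]] := fl x; have [N [s [s0 gN]]] := gl x.
have xx : `|x - x| = 0 by rewrite subrr normr0.
(* The product rule constant: the two factors in parentheses bound |f| and |g| on the common
   ball. *)
exists ((`|f x| + `|M| * r) * `|N| + (`|g x| + `|N| * s) * `|M|), (Num.min r s).
split; first by rewrite lt_min r0.
move=> y z; rewrite !lt_min => /andP[yr ys] /andP[zr zs] /=.
have fy : `|f y| <= `|f x| + `|M| * r.
  rewrite -lerBlDl (le_trans (lerB_dist _ _))// (le_trans (fM _ _ yr _)) ?xx//.
  by rewrite (le_trans (ler_wpM2r _ (ler_norm M)))// ler_wpM2l// ltW.
have gz : `|g z| <= `|g x| + `|N| * s.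
  rewrite -lerBlDl (le_trans (lerB_dist _ _))// (le_trans (gN _ _ zs _)) ?xx//.
  by rewrite (le_trans (ler_wpM2r _ (ler_norm N)))// ler_wpM2l// ltW.
rewrite (_ : f y * g y - f z * g z = f y * (g y - g z) + g z * (f y - f z)); last by ring.
rewrite (le_trans (ler_normD _ _))// !normrM mulrDl lerD//.
  rewrite -mulrA ler_pM// (le_trans (gN _ _ ys zs))//.
  by rewrite ler_wpM2r// ler_norm.
rewrite -mulrA ler_pM// (le_trans (fM _ _ yr zr))//.
by rewrite ler_wpM2r// ler_norm.
Qed.

Lemma locally_dist_le_clamp f c r : locally_dist_le f ->
  locally_dist_le (fun x => clamp c r (f x)).
Proof.
move=> fl x; have [M [s [s0 fM]]] := fl x; exists M, s; split => // y z ys zs.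
by rewrite (le_trans (clamp_lip _ _ _ _))// fM.
Qed.

End locally_dist_le_theory.

Section integration_by_parts.
Context {R : realType} {n : nat}.
Notation lam := (@lebesgue_rV R n).
Implicit Types (f g p : 'rV[R]_n -> R) (v x : 'rV[R]_n).

(** A local Lipschitz constant controls only short steps, so the quotients are bounded from some
    index on. One number [N] serves as this index and as both bounds, which lets a compactness
    argument along [\oo] deliver all three. *)
Lemma compact_dquot_bound g v (K : R) : locally_dist_le g ->
  exists N : nat, forall x, `|x| <= K ->
    `|g x| <= N%:R /\ forall m, (N <= m)%N -> `|dquot g v m x| <= N%:R.
Proof.
move=> gl; pose S : set 'rV[R]_n := [set w | `|w| <= K].
have cS : compact S by exact: compact_norm_le.
pose P (N : nat) x := `|g x| <= N%:R /\
   forall m, (N <= m)%N -> `|dquot g v m x| <= N%:R.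
have /compact_near_coveringP/(_ nat \oo P _) covS := cS.
have [|N _ HN] := covS; last first.
  by exists N => x xK; exact: (HN N (leqnn N) x xK).
move=> x _; have [M [r [r0 gM]]] := gl x.
have gx1 : \forall y \near x, `|g y - g x| < 1.
  have cg : continuous g by exact: locally_dist_le_continuous.
  move/cvgrPdist_lt : (cg x) => /(_ 1 ltr01).
  by apply: filterS => y; rewrite distrC.
have yr : \forall y \near x, `|y - x| < r / 2.
  by apply: near_dist_lt; rewrite subrr normr0 divr_gt0.
have v0 : 0 < `|v| + 1 by rewrite ltr_wpDl.
have [m0 m0r] := small_invS (divr_gt0 r0 (mulr_gt0 (ltr0Sn R 1) v0)).
(* [m0] makes the step shorter than r / 2, so that both points of the quotient lie in the ball where
   [g] is Lipschitz; the other entries bound |g| near x and the quotient. *)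
pose N0 := maxn m0 (maxn (Num.bound (`|g x| + 1)) (Num.bound (`|M| * `|v|))).
exists ([set y | `|g y - g x| < 1 /\ `|y - x| < r / 2], [set N | (N0 <= N)%N]).
  by split; [exact: filterI|exists N0].
move=> [y N] /= [[gy yx] N0N]; split.
  rewrite -(subrK (g x) (g y)) (le_trans (ler_normD _ _))//.
  have := archi_boundP (addr_ge0 (normr_ge0 (g x)) ler01).
  have : (Num.bound (`|g x| + 1))%:R <= N%:R :> R.
    by rewrite ler_nat (leq_trans _ N0N)// /N0 !leq_max leqnn orbT.
  move: gy; lra.
move=> m Nm.
have hm : `|m.+1%:R^-1 *: v| < r / 2.
  rewrite normrZ ger0_norm// (@le_lt_trans _ _ (m.+1%:R^-1 * (`|v| + 1)))//.
    by rewrite ler_wpM2l// lerDl.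
  rewrite -ltr_pdivlMr// (le_lt_trans _ (lt_le_trans m0r _))//.
    rewrite lef_pV2 ?posrE// ler_nat ltnS (leq_trans _ Nm)// (leq_trans _ N0N)//.
    by rewrite /N0 leq_max leqnn.
  by rewrite invfM mulrA.
rewrite /dquot normrM ger0_norm// mulrC -ler_pdivlMr//.
have xr : `|y - x| < r by rewrite (lt_trans yx)// ltr_pdivrMr// mulr_natr mulr2n ltrDl.
rewrite (le_trans (gM _ _ _ xr))//.
  rewrite -addrA (le_lt_trans (ler_normD _ _))//; lra.
rewrite addrK normrZ ger0_norm// mulrCA mulrC ler_wpM2r//.
rewrite (@le_trans _ _ (`|M| * `|v|))// ?ler_wpM2r// ?ler_norm//.
rewrite (le_trans (ltW (archi_boundP _)))// ?mulr_ge0// ler_nat.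
by rewrite (leq_trans _ N0N)// /N0 !leq_max leqnn !orbT.
Qed.

Lemma integral_derive_compact_supp g v : locally_dist_le g -> compact_supp g ->
  (\int[lam]_x ('D_v g x)%:E = 0)%E.
Proof.
move=> gl [K gK].
have cg := locally_dist_le_continuous gl.
have mg := continuous_measurable_rV cg.
have [N gN] := compact_dquot_bound v (`|K| + `|v|) gl.
have ig : lam.-integrable setT (EFin \o g).
  apply: (@compact_supp_integrable _ _ _ N%:R) => //; last by exists K.
  move=> x; have [xK|xK] := leP `|x| (`|K| + `|v|); first by have [] := gN x xK.
  rewrite gK ?normr0// (le_trans _ (ltW xK))// (le_trans (ler_norm _))//.
  by rewrite lerDl.
have dq0 m x : `|K| + `|v| < `|x| -> dquot g v m x = 0.
  move=> xK; rewrite /dquot !gK ?subrr ?mulr0//.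
    by rewrite (le_trans _ (ltW xK))// (le_trans (ler_norm _))// lerDl.
  have := lerB_normD x (m.+1%:R^-1 *: v); rewrite [x + _]addrC; apply: le_trans.
  rewrite lerBrDr (le_trans _ (ltW xK))// lerD ?ler_norm//.
  by rewrite normrZ ger0_norm// ler_piMl// invf_le1// ler1n.
(* The sequence is shifted by [N] because the bound on the quotients starts at that index. Steps of
   length at most |v| confine all quotients to |x| <= |K| + |v|, and the extra 1 makes the open ball
   contain this closed one. *)
have [|||||_ H] := @dominated_convergence_EFin _ _ _ lam
  (fun m => dquot g v (m + N)) ('D_v g)
  (fun x => N%:R * \1_[set x : 'rV[R]_n | `|x| < `|K| + `|v| + 1] x).
- by move=> m; exact: measurable_dquot.
- exact: measurable_derive.
- apply: (ae_imp (locally_lipschitz_ae_derivable v gl)) => x dx.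
  by rewrite (cvg_shiftn N (fun m => dquot g v m x)); exact: cvg_dquot.
- apply: (@compact_supp_integrable _ _ _ N%:R).
  + apply: measurable_funM => //; apply: measurable_indic.
    by apply: test_sets_measurable; exact: ball_test_set.
  + move=> x; rewrite indicE; case: (_ \in _); rewrite ?mulr1 ?mulr0 ?normr0//.
    by rewrite ger0_norm.
  + by exists (`|K| + `|v| + 1) => x Kx; rewrite indicE memNset ?mulr0//= ltNge Kx.
- apply: aeW => x m; have [xK|xK] := leP `|x| (`|K| + `|v|).
    have [_ /(_ (m + N)%N (leq_addl _ _))] := gN x xK.
    by rewrite indicE mem_set ?mulr1//= (le_lt_trans xK)// ltrDl.
  by rewrite dq0// normr0 mulr_ge0.
apply/esym; apply: (cvg_unique _ _ H) => //.
apply: cvg_near_cst; apply: nearW => m.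
rewrite /dquot; set h := _%:R^-1 *: v.
have igh : lam.-integrable setT (EFin \o (fun x => g (h + x))).
  by have := integrable_shift h ig; under eq_fun do rewrite addrC.
under eq_integral do rewrite EFinM.
rewrite integralZl//; last exact: (integrableB measurableT igh ig).
rewrite integralB_EFin//.
have -> : (\int[lam]_x (g (h + x))%:E = \int[lam]_x (g x)%:E)%E.
  rewrite -[RHS](integral_shift h); last exact/measurable_EFinP.
  by under [RHS]eq_integral do rewrite addrC.
rewrite subee ?mule0//.
exact: (integrable_fin_num measurableT ig).
Qed.


(** [clamp 2^-1 2^-1] is the projection onto [0, 1]; the result is 1 for |x| <= N, 0 for |x| >= 2 N,
    and decreases linearly in |x| with slope 1/N in between. *)
Let cutoff (N : R) x : R := clamp 2^-1 2^-1 (2 - N^-1 * `|x|).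

Let cutoff01 N x : 0 <= cutoff N x <= 1.
Proof.
have := @clamp_in _ 2^-1 2^-1 (2 - N^-1 * `|x|); rewrite /cutoff => /(_ ltac:(by [])).
by rewrite ler_norml => /andP[? ?]; apply/andP; split; lra.
Qed.

Let cutoff_lip N x y : 0 < N -> `|cutoff N x - cutoff N y| <= N^-1 * `|x - y|.
Proof.
move=> N0; rewrite (le_trans (clamp_lip _ _ _ _))//.
rewrite (_ : _ - _ = N^-1 * (`|y| - `|x|)); last by ring.
rewrite normrM (gtr0_norm (_ : 0 < N^-1)) ?invr_gt0// ler_wpM2l ?invr_ge0 ?(ltW N0)//.
have := lerB_dist x y; have := lerB_dist y x; rewrite (distrC y x) ler_norml => ? ?.
by apply/andP; split; lra.
Qed.

Let cutoff1 N x : 0 < N -> `|x| <= N -> cutoff N x = 1.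
Proof.
move=> N0 xN; have : N^-1 * `|x| <= 1 by rewrite ler_pdivrMl// mulr1.
have : 0 <= N^-1 * `|x| by rewrite mulr_ge0// invr_ge0 ltW.
rewrite /cutoff; move: (N^-1 * _) => t t0 t1; rewrite /clamp min_l ?max_r; lra.
Qed.

Let cutoff0 N x : 0 < N -> 2 * N <= `|x| -> cutoff N x = 0.
Proof.
move=> N0 xN; have : 2 <= N^-1 * `|x| by rewrite ler_pdivlMl// mulrC.
rewrite /cutoff; move: (N^-1 * _) => t t2; rewrite /clamp max_l ?subrr// ge_min.
by apply/orP; right; lra.
Qed.

Lemma derive_clamp_le f v x c r : derivable f x v ->
  derivable (fun y => clamp c r (f y)) x v ->
  `|'D_v (fun y => clamp c r (f y)) x| <= `|'D_v f x|.
Proof.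
move=> df dc; have /cvg_norm nf := cvg_dquot df; have /cvg_norm nc := cvg_dquot dc.
apply: (ler_cvg_to nc nf); apply: nearW => m.
by rewrite /dquot !normrM ler_wpM2l// clamp_lip.
Qed.

(* Truncating f at the same level j as the radius of the cutoff bounds the
   cutoff error |f_j| |D_v chi_j| p by |v| p, so f p need not be integrable. *)
Lemma integration_by_parts_derive f p v :
  locally_dist_le f -> locally_dist_le p ->
  (forall x, 0 <= p x) -> lam.-integrable setT (EFin \o p) ->
  lam.-integrable setT (fun x => (f x * 'D_v p x)%:E) ->
  lam.-integrable setT (fun x => (p x * 'D_v f x)%:E) ->
  (\int[lam]_x (f x * 'D_v p x)%:E = - \int[lam]_x (p x * 'D_v f x)%:E)%E.
Proof.
move=> fl pl p0 ip ifp ipf.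
have cf := locally_dist_le_continuous fl.
have cp := locally_dist_le_continuous pl.
have mf := continuous_measurable_rV cf.
have mp := continuous_measurable_rV cp.
pose fN (j : nat) x := clamp 0 j.+1%:R (f x).
pose chi (j : nat) x := cutoff j.+1%:R x.
have chil j : locally_dist_le (chi j).
  by apply: dist_le_locally => x y; exact: cutoff_lip.
have fNl j : locally_dist_le (fN j) by exact: locally_dist_le_clamp.
pose g j := chi j \* fN j \* p.
have gl j : locally_dist_le (g j).
  by apply: locally_dist_leM => //; exact: locally_dist_leM.
have cg j : continuous (g j) by exact: locally_dist_le_continuous.
have g0 j : (\int[lam]_x ('D_v (g j) x)%:E = 0)%E.
  apply: integral_derive_compact_supp => //; exists (2 * j.+1%:R) => x xj.
  by rewrite /g /= /chi cutoff0// !mul0r.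
have ae_der : {ae lam, forall x, (derivable f x v /\ derivable p x v) /\
    forall j, derivable (chi j) x v /\ derivable (fN j) x v}.
  apply: ae_and.
    by apply: ae_and; exact: locally_lipschitz_ae_derivable.
  apply/ae_foralln => j.
  by apply: ae_and; exact: locally_lipschitz_ae_derivable.
have DgE j x : derivable p x v -> derivable (chi j) x v -> derivable (fN j) x v ->
  'D_v (g j) x = chi j x * (fN j x * 'D_v p x) + chi j x * (p x * 'D_v (fN j) x)
    + fN j x * p x * 'D_v (chi j) x.
  move=> dp dc df; rewrite /g deriveM//; last exact: derivableM.
  rewrite deriveM//= /GRing.scale/=; ring.
have fN_le j x : `|fN j x| <= j.+1%:R.
  by have := @clamp_in _ 0 j.+1%:R (f x); rewrite subr0; exact.
have fN_le' j x : `|fN j x| <= `|f x|.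
  have := clamp_lip 0 j.+1%:R (f x) 0; rewrite subr0.
  by rewrite [clamp _ _ 0]clamp_id ?subr0 ?normr0.
have Dchi_le j x : `|'D_v (chi j) x| <= j.+1%:R^-1 * `|v|.
  apply: derive_le => h; apply: dist_le_line => y z; exact: cutoff_lip.
have chi_le j x : `|chi j x| <= 1.
  by have /andP[c0 c1] := cutoff01 j.+1%:R x; rewrite ger0_norm.
have [|||||_ H] := @dominated_convergence_EFin _ _ _ lam
  (fun j => 'D_v (g j)) (fun x => f x * 'D_v p x + p x * 'D_v f x)
  (fun x => `|f x * 'D_v p x| + `|p x * 'D_v f x| + `|v| * p x).
- by move=> j; exact: measurable_derive.
- by apply: measurable_funD; apply: measurable_funM => //; exact: measurable_derive.
- apply: (ae_imp ae_der) => x [[df dp] dj].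
  have near_fN : \forall j \near \oo, `|f x| < j.+1%:R.
    exists (Num.bound `|f x|) => // j /= fj.
    by rewrite (lt_le_trans (archi_boundP _))// ler_nat (leq_trans fj).
  have near_chi : \forall j \near \oo, `|x| < j.+1%:R.
    exists (Num.bound `|x|) => // j /= fj.
    by rewrite (lt_le_trans (archi_boundP _))// ler_nat (leq_trans fj).
  have fN_cvg : fN j x @[j --> \oo] --> f x.
    apply: cvg_near_cst; apply: filterS near_fN => j fj.
    by rewrite /fN clamp_id// subr0 ltW.
  have chi_cvg : chi j x @[j --> \oo] --> (1 : R).
    apply: cvg_near_cst; apply: filterS near_chi => j xj.
    by rewrite /chi cutoff1// ltW.
  have DfN_cvg : 'D_v (fN j) x @[j --> \oo] --> 'D_v f x.
    apply: cvg_near_cst; apply: filterS near_fN => j fj.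
    (* By continuity |f| stays below j + 1 near x, so [fN j] coincides with [f] there and has the
       same derivative. *)
    apply: near_eq_derive.
    have d0 : 0 < j.+1%:R - `|f x| by rewrite subr_gt0.
    move/cvgrPdist_lt : (cf x) => /(_ _ d0); apply: filterS => y fxy.
    rewrite /fN clamp_id// subr0 -(subrK (f x) (f y)) (le_trans (ler_normD _ _))//.
    by rewrite -lerBrDr distrC ltW.
  have Dchi_cvg : 'D_v (chi j) x @[j --> \oo] --> (0 : R).
    apply: norm_cvg0; apply: (@squeeze_cvgr _ _ _ _ (fun=> 0) (fun j => j.+1%:R^-1 * `|v|)).
    - by apply: nearW => j; rewrite normr_ge0/=.
    - exact: cvg_cst.
    rewrite -(mul0r `|v|); apply: cvgM; [exact: cvg_harmonic|exact: cvg_cst].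
  rewrite [X in X @ _ --> _](_ : _ = fun j => chi j x * (fN j x * 'D_v p x) +
     chi j x * (p x * 'D_v (fN j) x) + fN j x * p x * 'D_v (chi j) x); last first.
    by apply/funext => j; have [? ?] := dj j; rewrite DgE.
  rewrite (_ : f x * _ + _ = 1 * (f x * 'D_v p x) + 1 * (p x * 'D_v f x) +
    f x * p x * 0); last by ring.
  apply: cvgD; last by apply: cvgM => //; apply: cvgM => //; exact: cvg_cst.
  by apply: cvgD; apply: cvgM => //; apply: cvgM => //; exact: cvg_cst.
- have i1 := integrable_norm ifp; have i2 := integrable_norm ipf.
  have i3 := integrableZl measurableT `|v| ip.
  exact: (integrableD measurableT (integrableD measurableT i1 i2) i3).
- apply: (ae_imp ae_der) => x [[df dp] dj] j; have [dc dfN] := dj j.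
  rewrite DgE// (le_trans (ler_normD _ _))// lerD//.
    rewrite (le_trans (ler_normD _ _))// lerD// normrM.
      rewrite (@le_trans _ _ `|fN j x * 'D_v p x|)//; first by rewrite ler_piMl.
      by rewrite !normrM ler_wpM2r.
    rewrite (@le_trans _ _ `|p x * 'D_v (fN j) x|)//; first by rewrite ler_piMl.
    by rewrite !normrM ler_wpM2l// derive_clamp_le.
  rewrite !normrM (ger0_norm (p0 x)) mulrAC ler_wpM2r//.
  rewrite (le_trans (ler_pM _ _ (fN_le j x) (Dchi_le j x)))//.
  by rewrite mulrA divff// mul1r.
have H0 : (\int[lam]_x (f x * 'D_v p x + p x * 'D_v f x)%:E = 0)%E.
  apply: (cvg_unique _ H) => //.
  by apply: cvg_near_cst; apply: nearW => j; exact: g0.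
move: H0; under eq_integral do rewrite EFinD.
rewrite integralD_EFin// => H0.
have fin_pf := integrable_fin_num measurableT ipf.
by rewrite -[LHS]adde0 -(subee fin_pf) addeA H0 add0e.
Qed.

End integration_by_parts.

(** * Log-densities with a Lipschitz gradient *)

Section density_prob_integral.
Context {d} {T : measurableType d} {R : realType}.
Variables (mu : {sigma_finite_measure set T -> \bar R}) (p : T -> R).
Variable dp : prob_density mu p.
Notation P := (density_prob dp).

(** The measure with density [p] is dominated by [mu], and its Radon-Nikodym derivative equals [p]
    almost everywhere because both have the same integrals over all measurable sets; the change of
    variables for that derivative then applies. *)
Lemma ge0_integral_density_prob (g : T -> \bar R) :
  measurable_fun setT g -> (forall x, 0 <= g x)%E ->
  (\int[P]_x g x = \int[mu]_x (g x * (p x)%:E))%E.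
Proof.
move=> mg g0; have [mp p0 p1] := dp.
pose nu : {finite_measure set T -> \bar R} := P.
have Pmu : nu `<< mu.
  apply/null_content_dominatesP => A mA A0.
  by rewrite /nu /= /density_prob null_set_integral//; apply/measurable_EFinP;
    exact: measurable_funTS.
pose q := Radon_Nikodym_SigmaFinite.f nu mu.
have iq : mu.-integrable setT q by exact: Radon_Nikodym_SigmaFinite.f_integrable.
have qp : ae_eq mu setT q (EFin \o p).
  apply: integral_ae_eq => //; first exact/measurable_EFinP.
  by move=> A _ mA; rewrite -(Radon_Nikodym_SigmaFinite.f_integral Pmu mA).
rewrite -(Radon_Nikodym_SigmaFinite.change_of_variables Pmu g0 measurableT mg).
apply: ae_eq_integral => //.
- by apply: emeasurable_funM => //; exact: measurable_int iq.
- by apply: emeasurable_funM => //; exact/measurable_EFinP.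
- by apply: filterS qp => x /= /(_ I) <-.
Qed.

Lemma integrable_density_prob (g : T -> R) : measurable_fun setT g ->
  P.-integrable setT (EFin \o g) <->
  mu.-integrable setT (EFin \o (fun x => g x * p x)).
Proof.
move=> mg; have [mp p0 p1] := dp.
have absE : (\int[P]_x `|(g x)%:E| = \int[mu]_x `|(g x * p x)%:E|)%E.
  rewrite ge0_integral_density_prob//; last first.
    by apply: measurableT_comp => //; exact/measurable_EFinP.
  by apply: eq_integral => x _; rewrite EFinM abseM [`|(p x)%:E|%E]gee0_abs// lee_fin.
split=> /integrableP[_ gi]; apply/integrableP; split.
- by apply/measurable_EFinP; exact: measurable_funM.
- by rewrite -absE.
- exact/measurable_EFinP.
- by rewrite absE.
Qed.

Lemma integral_density_prob (g : T -> R) : measurable_fun setT g ->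
  (\int[P]_x (g x)%:E = \int[mu]_x (g x * p x)%:E)%E.
Proof.
move=> mg; have [mp p0 p1] := dp.
rewrite integralE [RHS]integralE; congr (_ - _)%E.
  rewrite ge0_integral_density_prob//; last first.
    by apply: measurable_funepos; exact/measurable_EFinP.
  apply: eq_integral => x _; rewrite !funeposE EFinM.
  by rewrite maxe_pMl ?mul0e// lee_fin.
rewrite ge0_integral_density_prob//; last first.
  by apply: measurable_funeneg; exact/measurable_EFinP.
apply: eq_integral => x _; rewrite !funenegE EFinM.
by rewrite -mulNe maxe_pMl ?mul0e// lee_fin.
Qed.

End density_prob_integral.

(** * Inner product and Euclidean norm *)

Section euclidean_theory.
Context {R : realType} {n : nat}.
Implicit Types u v w : 'rV[R]_n.

Lemma dotvC u v : dotv u v = dotv v u.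
Proof. by apply: eq_bigr => i _; rewrite mulrC. Qed.

Lemma dotv_ge0 u : 0 <= dotv u u.
Proof. by apply: sumr_ge0 => i _; rewrite -expr2 sqr_ge0. Qed.

Lemma enorm_ge0 u : 0 <= enorm u.
Proof. exact: sqrtr_ge0. Qed.

Lemma enorm_sqr u : enorm u ^+ 2 = dotv u u.
Proof. by rewrite /enorm sqr_sqrtr// dotv_ge0. Qed.

Lemma enormZ c u : enorm (c *: u) = `|c| * enorm u.
Proof.
rewrite /enorm dotvZr dotvC dotvZr mulrA -expr2 sqrtrM ?sqr_ge0//.
by rewrite sqrtr_sqr.
Qed.

Lemma coord_le_enorm u i : `|u ord0 i| <= enorm u.
Proof.
rewrite -[leLHS]ger0_norm// -[leLHS]sqrtr_sqr ler_sqrt ?dotv_ge0// real_normK ?num_real//.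
rewrite /dotv (bigD1 i)//= expr2 lerDl sumr_ge0// => j _.
by rewrite -expr2 sqr_ge0.
Qed.

Lemma norm_le_enorm u : `|u| <= enorm u.
Proof. by apply: norm_rV_le; [exact: enorm_ge0|exact: coord_le_enorm]. Qed.

Lemma enorm_le_norm u : enorm u <= Num.sqrt n%:R * `|u|.
Proof.
rewrite -[X in _ * X]ger0_norm// -[X in _ * X]sqrtr_sqr -sqrtrM// ler_sqrt; last first.
  by rewrite mulr_ge0// sqr_ge0.
rewrite /dotv (@le_trans _ _ (\sum_(i < n) `|u| ^+ 2))//.
  apply: ler_sum => i _; rewrite -expr2 -real_normK ?num_real//.
  by rewrite lerXn2r ?nnegrE// coord_le_norm.
by rewrite sumr_const card_ord mulr_natl.
Qed.

Lemma enorm_eq0 u : enorm u = 0 -> u = 0.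
Proof.
move=> u0; apply/rowP => i; rewrite mxE; apply/eqP; rewrite -normr_le0 -u0.
exact: coord_le_enorm.
Qed.

(** Cauchy-Schwarz, from the squared norm of <v,v> u - <u,v> v, which equals <v,v> (<u,u> <v,v> -
    <u,v>^2). *)
Lemma dotv_le_enorm u v : dotv u v <= enorm u * enorm v.
Proof.
have [v0|v0] := eqVneq (dotv v v) 0.
  have ev0 : enorm v = 0 by rewrite /enorm v0 sqrtr0.
  rewrite ev0 mulr0 /dotv big1// => i _.
  by rewrite (enorm_eq0 ev0) mxE mulr0.
have vv : 0 < dotv v v by rewrite lt_neqAle eq_sym v0 dotv_ge0.
have := dotv_ge0 (dotv v v *: u - dotv u v *: v).
rewrite dotvBr !dotvZr ![dotv (_ - _) _]dotvC !dotvBr !dotvZr (dotvC v u).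
rewrite (_ : _ - _ = dotv v v * (dotv u u * dotv v v - dotv u v ^+ 2)); last by ring.
rewrite pmulr_rge0// subr_ge0 => H.
rewrite /enorm -sqrtrM ?dotv_ge0// (le_trans (ler_norm _))// -sqrtr_sqr ler_sqrt//.
by rewrite mulr_ge0// dotv_ge0.
Qed.

Lemma normr_dotv_le u v : `|dotv u v| <= enorm u * enorm v.
Proof.
rewrite ler_norml dotv_le_enorm andbT lerNl -mulN1r -dotvZr.
by rewrite (le_trans (dotv_le_enorm _ _))// enormZ normrN1 mul1r.
Qed.

End euclidean_theory.

Lemma is_derive_quadratic (R : realType) (a b t : R) :
  is_derive t 1 (fun t => a * t + b * t ^+ 2) (a + 2 * b * t).
Proof.
have -> : (fun t => a * t + b * t ^+ 2) = a \*: (@id R) + b \*: (@id R ^+ 2).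
  by apply/funext => z; rewrite /GRing.add/= /GRing.scale/= /GRing.exp/= /GRing.mul/=.
apply: is_derive_eq.
by rewrite /GRing.scale/= mulr1 expr1 mulr1; ring.
Qed.

Lemma dotv_sqrD (R : realType) (n : nat) (h : R) (e w : 'rV[R]_n) :
  dotv (h *: e + w) (h *: e + w) =
  dotv w w + 2 * h * dotv w e + h ^+ 2 * dotv e e.
Proof.
rewrite dotvDr dotvZr [dotv (_ + w) e]dotvC [dotv (_ + _) w]dotvC !dotvDr !dotvZr.
by rewrite (dotvC e w); ring.
Qed.

(** * Tangent Gaussian, bounds on the density, and the sub-Gaussian score *)

Section log_density.
Context {R : realType} {n : nat}.
Variables (l : 'rV[R]_n -> R) (L : R).
Hypothesis L0 : 0 < L.
Hypothesis dl : forall x, differentiable l x.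
Hypothesis sL : forall x y, enorm (grad l x - grad l y) <= L * enorm (x - y).
Notation s := (grad l).
Implicit Types x y u v : 'rV[R]_n.

Lemma is_derive_line f v x (t : R) : differentiable f (t *: v + x) ->
  is_derive t 1 (fun t => f (t *: v + x)) (dotv (grad f (t *: v + x)) v).
Proof.
move=> df; have dv : derivable f (t *: v + x) v by exact: diff_derivable.
split; first exact/(derivable_lineE f x v t).2.
by rewrite -diff_grad// -deriveE// derive_lineE.
Qed.

Lemma line_MVT (F dF : R -> R) : (forall t : R, is_derive t 1 F (dF t)) ->
  exists2 c, 0 < c < 1 & F 1 - F 0 = dF c.
Proof.
move=> FdF; have [|c] := @MVT R F dF 0 1 ltr01 (fun z _ => FdF z).
  apply: continuous_subspaceT => t; apply: differentiable_continuous.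
  by apply/derivable1_diffP; have [] := FdF t.
by rewrite in_itv/= subr0 mulr1 => ? ?; exists c.
Qed.

(** Mean value theorem for F(t) = l(x + t u) - t <s x, u> + (L/2) |u|^2 t^2. The quadratic term is
    chosen so that F'(c) >= 0 for 0 < c < 1: by Cauchy-Schwarz and the Lipschitz bound, <s x - s (x
    + c u), u> <= L c |u|^2. *)
Lemma log_density_lower x u :
  l x + dotv (s x) u - L / 2 * dotv u u <= l (u + x).
Proof.
pose F t := l (t *: u + x) + (- dotv (s x) u * t + L / 2 * dotv u u * t ^+ 2).
pose dF t := dotv (s (t *: u + x)) u + (- dotv (s x) u + 2 * (L / 2 * dotv u u) * t).
have [t|c /andP[c0 c1]] := @line_MVT F dF.
  have dq := is_derive_quadratic (- dotv (s x) u) (L / 2 * dotv u u) t.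
  have dline : is_derive t 1 (fun t => l (t *: u + x)) (dotv (s (t *: u + x)) u).
    exact: is_derive_line.
  exact: is_deriveD.
rewrite /F /dF scale1r scale0r add0r expr1n expr0n /= !mulr0 !mulr1 !addr0 => E.
suff H : 0 <= dotv (s (c *: u + x)) u + (- dotv (s x) u + 2 * (L / 2 * dotv u u) * c).
  rewrite -subr_ge0; rewrite -E in H; apply: (le_trans H).
  by rewrite le_eqVlt; apply/orP; left; apply/eqP; ring.
have := dotv_le_enorm (s x - s (c *: u + x)) u.
have := sL x (c *: u + x).
rewrite (_ : x - (c *: u + x) = (- c) *: u); last first.
  by rewrite opprD addrCA subrr addr0 scaleNr.
rewrite enormZ normrN (gtr0_norm c0) => H1 H2.
have H3 : enorm (s x - s (c *: u + x)) * enorm u <= L * c * dotv u u.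
  rewrite (le_trans (ler_wpM2r (enorm_ge0 u) H1))// -enorm_sqr.
  by rewrite le_eqVlt; apply/orP; left; apply/eqP; ring.
have := le_trans H2 H3.
rewrite dotvC dotvBr ![dotv u _]dotvC => H4.
rewrite (_ : _ + _ = L * c * dotv u u -
  (dotv (s x) u - dotv (s (c *: u + x)) u)); last by field.
by rewrite subr_ge0.
Qed.

Lemma square_completion x u :
  dotv (s x) u - L / 2 * dotv u u =
  enorm (s x) ^+ 2 / (2 * L) - L / 2 * enorm (u - L^-1 *: s x) ^+ 2.
Proof.
rewrite !enorm_sqr dotvBr dotvZr ![dotv (_ - _) _]dotvC !dotvBr !dotvZr.
by rewrite (dotvC u (s x)); field; rewrite gt_eqF.
Qed.

Variable p : 'rV[R]_n -> R.
Hypothesis pE : forall x, p x = expR (l x).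

Let p_ge0 x : 0 <= p x. Proof. by rewrite pE expR_ge0. Qed.

Let m x := x + L^-1 *: s x.
Let C x := p x * expR (enorm (s x) ^+ 2 / (2 * L)).

Let sub_m x : x - m x = (- L^-1) *: s x.
Proof. by rewrite /m opprD addrA subrr sub0r scaleNr. Qed.

Lemma tangent_gaussian_le x y :
  C x * expR (- (L / 2) * enorm (y - m x) ^+ 2) <= p y.
Proof.
rewrite /C !pE -!expRD ler_expR; have := log_density_lower x (y - x).
rewrite subrK -addrA square_completion /m; apply: le_trans.
by rewrite mulNr -[in leLHS]addrA (opprD x) (addrA y).
Qed.

Lemma tangent_gaussian_eq x :
  C x * expR (- (L / 2) * enorm (x - m x) ^+ 2) = p x.
Proof.
rewrite /C -mulrA -expRD sub_m enormZ exprMn normrN gtr0_norm ?invr_gt0//.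
rewrite (_ : _ + _ = 0) ?expR0 ?mulr1//.
by field; rewrite gt_eqF.
Qed.

Lemma is_derive_expR_comp f x v (D : R) :
  is_derive x v f D -> is_derive x v (fun y => expR (f y)) (expR (f x) * D).
Proof.
move=> [df Df].
have dline : is_derive (0 : R) 1 (fun h : R => f (h *: v + x)) D.
  by split; [exact: (derivable1P f x v).1|rewrite derive_line0].
have := @is_derive1_comp R expR (fun h : R => f (h *: v + x)) 0 _ _
  (is_derive_expR _) dline.
rewrite scale0r add0r => -[dc Dc]; split.
  exact: (derivable1P (fun y => expR (f y)) x v).2.
by rewrite -derive_line0.
Qed.

Lemma derive_density x v : is_derive x v p (p x * dotv (s x) v).
Proof.
rewrite pE (_ : p = fun y => expR (l y)); last exact/funext/pE.
apply: is_derive_expR_comp; split; first exact: diff_derivable.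
by rewrite deriveE// diff_grad.
Qed.

Lemma grad_density x : grad p x = p x *: s x.
Proof.
apply/rowP => j; rewrite !mxE; have [_ ->] := derive_density x (delta_mx ord0 j).
by rewrite dotv_delta mxE.
Qed.

(** On a coordinate line through x the exponent is a quadratic polynomial in the step, with linear
    coefficient - L <x - m x, e> = s_j. The chain rule multiplies it by the value of the Gaussian at
    x, which is p x. *)
Lemma grad_tangent_gaussian x :
  grad (fun y => C x * expR (- (L / 2) * enorm (y - m x) ^+ 2)) x = grad p x.
Proof.
rewrite grad_density; apply/rowP => j; rewrite !mxE.
set e := delta_mx ord0 j; set w := x - m x.
have we : dotv w e = - (L^-1 * s x ord0 j).
  by rewrite /w sub_m dotvC dotvZr dotvC dotv_delta mulNr.
have dq : is_derive x e (fun y => - (L / 2) * enorm (y - m x) ^+ 2) (s x ord0 j).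
  have lineE : (fun h : R => - (L / 2) * enorm (h *: e + x - m x) ^+ 2) =
      cst (- (L / 2) * enorm w ^+ 2) +
      (fun h => s x ord0 j * h + (- (L / 2) * dotv e e) * h ^+ 2).
    apply/funext => h; rewrite !fctE -addrA -/w !enorm_sqr.
    by rewrite dotv_sqrD we; field; rewrite gt_eqF.
  have D0 : is_derive (0 : R) 1
      (fun h : R => - (L / 2) * enorm (h *: e + x - m x) ^+ 2) (s x ord0 j).
    have := is_deriveD (is_derive_cst (- (L / 2) * enorm w ^+ 2) (0 : R) (1 : R))
      (is_derive_quadratic (s x ord0 j) (- (L / 2) * dotv e e) 0).
    by rewrite lineE mulr0 addr0 add0r.
  have [dc Dc] := D0; split; first exact: (derivable1P _ x e).2.
  by rewrite -derive_line0.
have [de De] := is_derive_expR_comp dq.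
rewrite (_ : (fun y => _) = C x \*: (fun y => expR (- (L / 2) * enorm (y - m x) ^+ 2)))//.
rewrite deriveZ// De /GRing.scale/= mulrA tangent_gaussian_eq.
by rewrite mxE.
Qed.


Hypothesis dp : prob_density (lebesgue_rV n) p.
Notation lam := (lebesgue_rV n).

Let unit_box (c : 'rV[R]_n) : set 'rV[R]_n :=
  [set y | forall i, `[c ord0 i - 2^-1, c ord0 i + 2^-1]%classic (y ord0 i)].

Let measurable_unit_box c : measurable (unit_box c).
Proof.
exact: (measurable_rV_box (fun i => measurable_itv
  `[c ord0 i - 2^-1, c ord0 i + 2^-1])).
Qed.

Let lebesgue_unit_box c : lam (unit_box c) = 1%E.
Proof.
rewrite (lebesgue_rV_box (fun i => measurable_itv `[c ord0 i - 2^-1, c ord0 i + 2^-1])).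
rewrite big1// => i _; rewrite lebesgue_measure_itv/= lte_fin ifT; last by lra.
by rewrite -EFinD; congr (_%:E); lra.
Qed.

(* Integrate the tangent Gaussian at x over the unit box around its mean, where
   its exponent is at least - L n / 8. *)
Lemma density_exp_score_le x :
  p x * expR (enorm (s x) ^+ 2 / (2 * L)) <= expR (L * n%:R / 8).
Proof.
have [mp p0 p1] := dp.
have Cle : (\int[lam]_(y in unit_box (m x)) (C x * expR (- (L * n%:R / 8)))%:E <= 1)%E.
  rewrite -p1; apply: (@le_trans _ _ (\int[lam]_(y in unit_box (m x)) (p y)%:E)%E).
    apply: ge0_le_integral => //.
    - by move=> y _; rewrite lee_fin mulr_ge0 ?expR_ge0// mulr_ge0 ?expR_ge0.
    - by apply/measurable_EFinP; exact: measurable_funTS.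
    move=> y yB; rewrite lee_fin; apply: le_trans (tangent_gaussian_le x y).
    rewrite ler_wpM2l ?mulr_ge0 ?expR_ge0// ler_expR mulNr lerN2.
    rewrite (_ : L * _ / 8 = L / 2 * (n%:R / 4)); last by field.
    rewrite ler_wpM2l ?divr_ge0 ?(ltW L0)// enorm_sqr /dotv.
    rewrite (@le_trans _ _ (\sum_(i < n) 4^-1))//; last first.
      by rewrite sumr_const card_ord -[_ *+ n]mulr_natl lexx.
    apply: ler_sum => i _; have := yB i; rewrite /= in_itv/= => /andP[y1 y2].
    rewrite !mxE -expr2 -real_normK ?num_real//.
    rewrite (_ : 4^-1 = 2^-1 ^+ 2 :> R); last by field.
    rewrite lerXn2r ?nnegrE// ler_norml; move: y1 y2; rewrite !mxE => y1 y2.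
    by apply/andP; split; lra.
  apply: ge0_subset_integral => //.
    exact/measurable_EFinP.
  by move=> y _; rewrite lee_fin.
move: Cle; rewrite integral_cst//= lebesgue_unit_box mule1 lee_fin expRN.
by rewrite ler_pdivrMr ?expR_gt0// mul1r.
Qed.

Lemma density_le x : p x <= expR (L * n%:R / 8).
Proof.
apply: le_trans (density_exp_score_le x); rewrite ler_peMr//.
by rewrite -expR0 ler_expR divr_ge0 ?sqr_ge0// mulr_ge0// ltW.
Qed.

(** With z = |s x|^2 / (2 L), the bound exp z >= 1 + z gives (1 + 2 L) exp z >= 1 + |s x|^2 >= |s
    x|; the factor 1 + 2 L turns z into |s x|^2. *)
Lemma density_score_le x :
  p x * enorm (s x) <= (1 + 2 * L) * expR (L * n%:R / 8).
Proof.
apply: (@le_trans _ _ ((1 + 2 * L) * (p x * expR (enorm (s x) ^+ 2 / (2 * L))))); last first.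
  by rewrite ler_wpM2l ?density_exp_score_le// addr_ge0// mulr_ge0// ltW.
rewrite mulrCA ler_wpM2l//.
have e1 := expR_ge1Dx (enorm (s x) ^+ 2 / (2 * L)).
have L1 : 0 <= 1 + 2 * L by rewrite addr_ge0// mulr_ge0// ltW.
rewrite (le_trans _ (ler_wpM2l L1 e1))//.
rewrite (_ : (1 + 2 * L) * _ = 1 + 2 * L + enorm (s x) ^+ 2 +
  enorm (s x) ^+ 2 / (2 * L)); last first.
  by field; rewrite gt_eqF.
have : 0 <= enorm (s x) ^+ 2 / (2 * L) by rewrite divr_ge0 ?sqr_ge0// mulr_ge0// ltW.
move: (enorm (s x)) => e; have := sqr_ge0 (e - 1); have := L0; nra.
Qed.

(** Mean value theorem along the segment, where the gradient p s is bounded by [density_score_le];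
    sqrt n converts the Euclidean length of the segment into its sup norm. *)
Lemma density_lipschitz : exists2 K, 0 <= K & forall x y, `|p x - p y| <= K * `|x - y|.
Proof.
exists ((1 + 2 * L) * expR (L * n%:R / 8) * Num.sqrt n%:R).
  by rewrite !mulr_ge0 ?expR_ge0 ?sqrtr_ge0// addr_ge0// mulr_ge0// ltW.
move=> x y; pose F t := p (t *: (x - y) + y).
have [t|c _] := @line_MVT F (fun t =>
  p (t *: (x - y) + y) * dotv (s (t *: (x - y) + y)) (x - y)).
  have dd := derive_density (t *: (x - y) + y) (x - y).
  have [de De] := dd.
  split; first exact: (derivable_lineE p y (x - y) t).2.
  by rewrite -De derive_lineE.
rewrite /F scale1r scale0r add0r subrK => ->.
set z := _ + y; rewrite normrM (ger0_norm (p_ge0 _)).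
rewrite (le_trans (ler_wpM2l (p_ge0 _) (normr_dotv_le _ _)))// mulrA.
rewrite -[leRHS]mulrA ler_pM ?mulr_ge0 ?expR_ge0 ?enorm_ge0 ?density_score_le//.
exact: enorm_le_norm.
Qed.

Lemma score_lipschitz x y : `|s x - s y| <= (L * Num.sqrt n%:R) * `|x - y|.
Proof.
rewrite (le_trans (norm_le_enorm _))// (le_trans (sL _ _))// -mulrA.
by rewrite ler_wpM2l ?(ltW L0)// enorm_le_norm.
Qed.

Lemma measurable_score i : measurable_fun setT (fun x => s x ord0 i).
Proof.
apply: continuous_measurable_rV.
apply: (@dist_le_continuous _ _ _ _ (L * Num.sqrt n%:R)) => x y.
apply: le_trans (score_lipschitz x y).
by have := coord_le_norm (s x - s y) i; rewrite !mxE.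
Qed.

Lemma measurable_dotv_score t : measurable_fun setT (fun x => dotv t (s x)).
Proof.
rewrite /dotv; apply: measurable_sum => i; apply: measurable_funM => //.
exact: measurable_score.
Qed.

Notation P := (density_prob dp).

(* Exponentiate the lower bound of log_density_lower and integrate over x. *)
Lemma score_subgaussian t :
  (\int[P]_x (expR (dotv t (s x)))%:E <= (expR (L * enorm t ^+ 2 / 2))%:E)%E.
Proof.
have [mp p0 p1] := dp.
have me : measurable_fun setT (fun x => expR (dotv t (s x))).
  by apply: measurableT_comp => //; exact: measurable_dotv_score.
rewrite integral_density_prob//.
apply: (@le_trans _ _ (\int[lam]_x ((expR (L * enorm t ^+ 2 / 2))%:E * (p (x + t))%:E))%E).
  apply: ge0_le_integral => //.
  - by move=> x _; rewrite lee_fin mulr_ge0// expR_ge0.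
  - by apply/measurable_EFinP; exact: measurable_funM.
  - under eq_fun do rewrite -EFinM.
    apply/measurable_EFinP; apply: measurable_funM => //.
    exact: (measurableT_comp mp (measurable_rV_shift t)).
  move=> x _; rewrite -EFinM lee_fin !pE -!expRD ler_expR.
  have := log_density_lower x t; rewrite -enorm_sqr dotvC [t + x]addrC; lra.
rewrite ge0_integralZl//; last 2 first.
- apply/measurable_EFinP; exact: (measurableT_comp mp (measurable_rV_shift t)).
- by move=> x _; rewrite lee_fin.
rewrite (integral_shift t (f := fun x => (p x)%:E)); last exact/measurable_EFinP.
by rewrite p1 mule1.
Qed.

Lemma integrable_exp_score t :
  P.-integrable setT (fun x => (expR (dotv t (s x)))%:E).
Proof.
apply/integrableP; split.
  by apply/measurable_EFinP; apply: measurableT_comp => //; exact: measurable_dotv_score.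
apply: le_lt_trans (ltry (expR (L * enorm t ^+ 2 / 2))).
apply: le_trans (score_subgaussian t); rewrite le_eqVlt; apply/orP; left; apply/eqP.
by apply: eq_integral => x _; rewrite /= ger0_norm ?expR_ge0.
Qed.

End log_density.

(** * Jacobians of maps that are Lipschitz for the Euclidean norm *)

Section enorm_lipschitz.
Context {R : realType} {n m : nat}.
Variables (F : 'rV[R]_n -> 'rV[R]_m) (L : R).
Hypothesis F_lip : forall x y, enorm (F x - F y) <= L * enorm (x - y).

Lemma enorm_lip_dotv_line (y : 'rV[R]_m) (x v : 'rV[R]_n) (h : R) :
  `|dotv y (F (h *: v + x)) - dotv y (F x)| <= (enorm y * (L * enorm v)) * `|h|.
Proof.
rewrite -dotvBr; set d := F _ - F _.
rewrite (le_trans (normr_dotv_le _ _))// -mulrA ler_wpM2l ?enorm_ge0//.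
by rewrite (le_trans (F_lip _ _))// addrK enormZ [`|h| * _]mulrC mulrA.
Qed.

Lemma enorm_lip_derive_coord (x v : 'rV[R]_n) (i : 'I_m) :
  `|'D_v (fun y => F y ord0 i) x| <= L * enorm v.
Proof.
apply: derive_le => h.
have := coord_le_enorm (F (h *: v + x) - F x) i; rewrite !mxE => /le_trans; apply.
by rewrite (le_trans (F_lip _ _))// addrK enormZ [`|h| * _]mulrC mulrA.
Qed.

(** For y the image of v under the Jacobian, |y|^2 is the derivative along v of the scalar function
    <y, F>, hence at most |y| L |v|; dividing by |y| gives the bound. *)
Lemma opnorm_jac_le x : 0 <= L -> differentiable F x -> opnorm (jac F x) <= L.
Proof.
move=> L0 dF; have dFi i : differentiable (fun y => F y ord0 i) x.
  exact: (differentiable_comp dF (differentiable_coord _ _ _)).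
apply: ge_sup.
  exists (enorm (0 *m (jac F x)^T)), 0 => //=.
  by rewrite /enorm /dotv big1 ?sqrtr0// => i _; rewrite mxE mulr0.
move=> _ [v /= v1 <-]; set y := v *m _.
have yE i : y ord0 i = 'D_v (fun z => F z ord0 i) x.
  rewrite deriveE// diff_grad// /y !mxE /dotv; apply: eq_bigr => j _.
  by rewrite !mxE mulrC.
have yyE : dotv y y = 'D_v (fun z => dotv y (F z)) x.
  have -> : (fun z => dotv y (F z)) = \sum_(i < m) (y ord0 i \*: (fun z => F z ord0 i)).
    by apply/funext => z; rewrite fct_sumE.
  rewrite derive_sum; last by move=> i; apply: derivableZ; exact: diff_derivable.
  apply: eq_bigr => i _; rewrite deriveZ; last exact: diff_derivable.
  by rewrite [in LHS]yE /GRing.scale/= mulrC yE.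
have : enorm y * enorm y <= enorm y * (L * enorm v).
  rewrite -expr2 enorm_sqr yyE (le_trans (ler_norm _))//.
  by apply: derive_le => h; exact: enorm_lip_dotv_line.
have [->|y0] := eqVneq (enorm y) 0; first by [].
rewrite ler_pM2l; last by rewrite lt_neqAle eq_sym y0 enorm_ge0.
by move=> /le_trans; apply; rewrite -[leRHS]mulr1 ler_wpM2l.
Qed.

End enorm_lipschitz.

(** * Moments of the score and of the Hessian, and Stein's identity *)

Section score_moments.
Context {R : realType} {n : nat}.
Variables (p l : 'rV[R]_n -> R) (L : R).
Hypothesis L0 : 0 < L.
Hypothesis dl : forall x, differentiable l x.
Hypothesis sL : forall x y, enorm (grad l x - grad l y) <= L * enorm (x - y).
Hypothesis pE : forall x, p x = expR (l x).
Hypothesis dp : prob_density (lebesgue_rV n) p.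
Notation s := (grad l).
Notation lam := (lebesgue_rV n).
Notation P := (density_prob dp).

Let score_dist_le i x y : `|s x ord0 i - s y ord0 i| <= (L * Num.sqrt n%:R) * `|x - y|.
Proof.
apply: le_trans (score_lipschitz L0 sL x y).
by have := coord_le_norm (s x - s y) i; rewrite !mxE.
Qed.

Lemma hessE x i j : hess l x i j = 'D_(delta_mx ord0 j) (fun y => s y ord0 i) x.
Proof. by rewrite !mxE. Qed.

(** Valid at every point, the default value 0 included; this gives integrability of the Hessian and
    of all monomials in its entries. *)
Lemma hess_le x i j : `|hess l x i j| <= L.
Proof.
rewrite hessE (le_trans (enorm_lip_derive_coord sL _ _ _))//.
by rewrite /enorm dotv_delta mxE !eqxx sqrtr1 mulr1.
Qed.

Lemma measurable_hess i j : measurable_fun setT (fun x => hess l x i j).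
Proof.
under eq_fun do rewrite hessE.
apply: measurable_derive; exact: dist_le_continuous (score_dist_le i).
Qed.

(** The sup norm of the score is attained at a coordinate, so exp(N |s|) is at most 1 plus the sum
    over i of exp(N s_i) + exp(- N s_i), and these exponentials are integrable by the sub-Gaussian
    estimate. *)
Lemma integrable_score_growth (g : 'rV[R]_n -> R) (N : R) : 0 <= N ->
  measurable_fun setT g -> (forall x, `|g x| <= expR (N * `|s x|)) ->
  P.-integrable setT (EFin \o g).
Proof.
move=> N0 mg gN.
pose e (c : R) i x := expR (dotv (c *: delta_mx ord0 i) (s x)).
pose G x : R := 1 + \sum_(i < n) (e N i x + e (- N) i x).
have eE c i x : e c i x = expR (c * s x ord0 i).
  by rewrite /e dotvC dotvZr dotv_delta.
have ie c i : P.-integrable setT (fun x => (e c i x)%:E).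
  exact: (integrable_exp_score L0 dl sL pE dp (c *: delta_mx ord0 i)).
have iG : P.-integrable setT (EFin \o G).
  have i1 : P.-integrable setT (EFin \o cst (1 : R)).
    exact: finite_measure_integrable_cst.
  have i2 : P.-integrable setT (fun x => \sum_(i < n) ((e N i x)%:E + (e (- N) i x)%:E))%E.
    by apply: integrable_sum => // i _; exact: integrableD.
  have := integrableD measurableT i1 i2; congr (_.-integrable _ _).
  by apply/funext => x /=; rewrite /G EFinD -sumEFin.
apply: le_integrable iG => //; first exact/measurable_EFinP.
move=> x _ /=; rewrite lee_fin (le_trans (gN x))// ger0_norm; last first.
  by rewrite addr_ge0// sumr_ge0// => i _; rewrite addr_ge0// expR_ge0.
have e0 i : 0 <= e N i x + e (- N) i x by rewrite addr_ge0// expR_ge0.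
(* The summand 1 of [G] settles |s x| = 0, and with it dimension 0, where no coordinate attains the
   norm. *)
rewrite /G; have [sx0|sx0] := eqVneq `|s x| 0.
  by rewrite sx0 mulr0 expR0 lerDl sumr_ge0.
have [[i0 i] /= sxi] := mx_norm_neq0 (sx0 : mx_norm (s x) != 0).
have -> : `|s x| = `|s x ord0 i| by rewrite [LHS]sxi (ord1 i0).
rewrite (bigD1 i)//= addrCA (@le_trans _ _ (e N i x + e (- N) i x))//; last first.
  by rewrite lerDl addr_ge0// sumr_ge0.
rewrite !eE mulNr; have [sp|sn] := leP 0 (s x ord0 i).
  by rewrite ger0_norm// lerDl expR_ge0.
by rewrite ltr0_norm// mulrN lerDr expR_ge0.
Qed.

Lemma integrable_score i : P.-integrable setT (fun x => (s x ord0 i)%:E).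
Proof.
apply: (@integrable_score_growth _ 1) => //; first exact: measurable_score L0 sL i.
move=> x; rewrite mul1r (le_trans (coord_le_norm _ _))//.
by rewrite (le_trans _ (expR_ge1Dx _))// lerDr.
Qed.

Lemma integrable_scoreM i j :
  P.-integrable setT (fun x => (s x ord0 i * s x ord0 j)%:E).
Proof.
apply: (@integrable_score_growth _ 2) => //.
  by apply: measurable_funM; exact: measurable_score L0 sL _.
move=> x; rewrite normrM mulr_natl mulr2n expRD ler_pM//.
  by rewrite (le_trans (coord_le_norm _ _))// (le_trans _ (expR_ge1Dx _))// lerDr.
by rewrite (le_trans (coord_le_norm _ _))// (le_trans _ (expR_ge1Dx _))// lerDr.
Qed.

(** Since r <= exp r, a monomial of total degree N in the coordinates is at most exp(N |s|). *)
Lemma score_moments : polynomial_moments_finite P s.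
Proof.
move=> a; pose N : R := \sum_(i < 1) \sum_(j < n) (a i j)%:R.
have N0 : 0 <= N by apply: sumr_ge0 => i _; exact: sumr_ge0.
apply: (@integrable_score_growth _ N) => //.
  apply: measurable_prod => i _; apply: measurable_prod => j _.
  by rewrite (ord1 i); apply: measurable_funX; exact: measurable_score L0 sL _.
move=> x; rewrite /N big_distrl/= expR_sum normr_prod.
apply: ler_prod => i _; rewrite normr_ge0/=.
rewrite big_distrl/= expR_sum normr_prod; apply: ler_prod => j _; rewrite normr_ge0/=.
rewrite normrX expRM_natl lerXn2r ?nnegrE ?expR_ge0// (ord1 i).
by rewrite (le_trans (coord_le_norm _ _))// (le_trans _ (expR_ge1Dx _))// lerDr.
Qed.

Lemma integrable_bounded_prob (g : 'rV[R]_n -> R) B : measurable_fun setT g ->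
  (forall x, `|g x| <= B) -> P.-integrable setT (EFin \o g).
Proof.
move=> mg gB; apply: measurable_bounded_integrable => //.
  by have [_ _ p1] := dp; rewrite /= /density_prob p1 ltry.
exists B; split; first exact: num_real.
by move=> M BM x _ /=; rewrite (le_trans (gB x))// ltW.
Qed.

Lemma hess_moments : polynomial_moments_finite P (hess l).
Proof.
move=> a; apply: (@integrable_bounded_prob _ (\prod_(i < n) \prod_(j < n) L ^+ a i j)).
  apply: measurable_prod => i _; apply: measurable_prod => j _.
  by apply: measurable_funX; exact: measurable_hess.
move=> x; rewrite normr_prod; apply: ler_prod => i _; rewrite normr_ge0/=.
rewrite normr_prod; apply: ler_prod => j _; rewrite normr_ge0/=.
by rewrite normrX lerXn2r ?nnegrE ?hess_le// ltW.
Qed.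

(** Integration by parts against [p] along the j-th basis vector, where D_j p = p s_j; [p] qualifies
    because it is Lipschitz and integrable. *)
Lemma stein_coord (f : 'rV[R]_n -> R) j : locally_dist_le f ->
  P.-integrable setT (fun x => (grad f x ord0 j)%:E) ->
  P.-integrable setT (fun x => (f x * s x ord0 j)%:E) ->
  (\int[P]_x (f x * s x ord0 j)%:E = - \int[P]_x (grad f x ord0 j)%:E)%E.
Proof.
move=> fl ig ifs; have [mp p0 p1] := dp.
have [K _ pK] := density_lipschitz L0 dl sL pE dp.
have mg := (measurable_EFinP _ _).1 (measurable_int _ ig).
have mfs := (measurable_EFinP _ _).1 (measurable_int _ ifs).
have Dp x : 'D_(delta_mx ord0 j) p x = p x * s x ord0 j.
  by have [_ ->] := derive_density dl pE x (delta_mx ord0 j); rewrite dotv_delta.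
rewrite !integral_density_prob//.
have E1 : (fun x => (f x * s x ord0 j * p x)%:E) =
    (fun x => (f x * 'D_(delta_mx ord0 j) p x)%:E).
  by apply/funext => x; rewrite Dp -mulrA (mulrC (p x)).
have E2 : (fun x => (grad f x ord0 j * p x)%:E) =
    (fun x => (p x * 'D_(delta_mx ord0 j) f x)%:E).
  by apply/funext => x; rewrite mxE mulrC.
rewrite E1 E2; apply: integration_by_parts_derive => //.
- exact: dist_le_locally pK.
- apply/integrableP; split; first exact/measurable_EFinP.
  rewrite (_ : integral _ _ _ = 1%E) ?ltry// -p1; apply: eq_integral => x _.
  by rewrite /= ger0_norm.
- by rewrite -E1; exact: (integrable_density_prob dp mfs).1.
- by rewrite -E2; exact: (integrable_density_prob dp mg).1.
Qed.

Lemma score_mean0 j : (\int[P]_x (s x ord0 j)%:E = 0)%E.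
Proof.
have grad1 x : grad (cst (1 : R)) x ord0 j = 0 by rewrite mxE derive_cst.
have E1 : (fun x => (cst (1 : R) x * s x ord0 j)%:E) = (fun x => (s x ord0 j)%:E).
  by apply/funext => x; rewrite /= mul1r.
have E2 : (fun x => (grad (cst (1 : R)) x ord0 j)%:E) = cst 0%E.
  by apply/funext => x; rewrite grad1.
rewrite -E1 stein_coord ?E1 ?E2; first by rewrite integral0 oppe0.
- by apply: (@dist_le_locally _ _ _ 0) => x y; rewrite subrr normr0 mul0r.
- exact: integrable0.
- exact: integrable_score.
Qed.

(** Stein's identity for f = s_i, which is Lipschitz and whose gradient is the i-th row of the
    Hessian. *)
Lemma score_covariance i j :
  (\int[P]_x (s x ord0 i * s x ord0 j)%:E = - \int[P]_x (hess l x i j)%:E)%E.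
Proof.
have hE : (fun x => (hess l x i j)%:E) = (fun x => (grad (fun y => s y ord0 i) x ord0 j)%:E).
  by apply/funext => x; rewrite !mxE.
rewrite hE; apply: stein_coord.
- exact: dist_le_locally (score_dist_le i).
- rewrite -hE; apply: (@integrable_bounded_prob _ L); first exact: measurable_hess.
  by move=> x; exact: hess_le.
- exact: integrable_scoreM.
Qed.

End score_moments.

Theorem proposition1p1 (R : realType) (k : nat) (p : 'rV[R]_k -> R)
    (dp : prob_density (lebesgue_rV k) p) (L : R)
    (P := density_prob dp)
    (logp := fun x => ln (p x)) (score := grad logp) :
  (forall x, 0 < p x) ->
  (forall x, differentiable logp x) ->
  0 < L ->
  (forall x y, enorm (score x - score y) <= L * enorm (x - y)) ->
  ({ae lebesgue_rV k, forall x, differentiable score x} /\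
   (forall x, differentiable score x -> opnorm (hess logp x) <= L)) /\
  ((forall x0, exists (C : R) (m : 'rV[R]_k),
      let g := fun x => C * expR (- (L / 2) * enorm (x - m) ^+ 2) in
      [/\ 0 < C, g x0 = p x0, grad g x0 = grad p x0 &
          forall x, g x <= p x]) /\
   closure [set x | p x != 0] = setT) /\
  (exists M : R, forall x, p x <= M) /\
  lipschitz p /\
  ((forall f : 'rV[R]_k -> R,
      locally_lipschitz f ->
      mx_integrable P (grad f) ->
      mx_integrable P (fun x => f x *: score x) ->
      forall j, 'E_P[fun x => (f x *: score x) ord0 j] =
                - 'E_P[fun x => grad f x ord0 j])%E /\
   (forall (m : nat) (f : 'rV[R]_k -> 'rV[R]_m),
      locally_lipschitz f ->
      (forall i, mx_integrable P (grad (fun x => f x ord0 i))) ->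
      (forall i, mx_integrable P (fun x => f x ord0 i *: score x)) ->
      forall i j, 'E_P[fun x => ((f x)^T *m score x) i j] =
                  - 'E_P[fun x => jac f x i j])%E /\
   (forall f : 'rV[R]_k -> 'rV[R]_k,
      locally_lipschitz f ->
      (forall i, mx_integrable P (grad (fun x => f x ord0 i))) ->
      (forall i, mx_integrable P (fun x => f x ord0 i *: score x)) ->
      'E_P[fun x => dotv (score x) (f x)] = - 'E_P[divergence f])%E) /\
  ((forall j, 'E_P[fun x => score x ord0 j] = 0)%E /\
   (forall i j,
      covariance P (fun x => score x ord0 i) (fun x => score x ord0 j) =
      - 'E_P[fun x => hess logp x i j])%E) /\
  ((forall t : 'rV[R]_k,
      'E_P[fun x => expR (dotv t (score x))] <=
      (expR (L * enorm t ^+ 2 / 2))%:E)%E /\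
   polynomial_moments_finite P score /\
   polynomial_moments_finite P (hess logp)).
Proof.
move=> p_gt0 dl L0 sL.
have pE x : p x = expR (logp x) by rewrite /logp lnK// posrE.
have [mp p0 p1] := dp.
have locE (m : nat) (f : 'rV[R]_k -> 'rV[R]_m) i : locally_lipschitz f ->
    locally_dist_le (fun x => f x ord0 i).
  move=> /locally_lipschitz_dist_le fl x; have [M [r [r0 fM]]] := fl x.
  exists M, r; split => // y z yr zr; apply: le_trans (fM _ _ yr zr).
  by have := coord_le_norm (f y - f z) i; rewrite !mxE.
have steinE (f : 'rV[R]_k -> R) j : locally_dist_le f ->
    mx_integrable P (grad f) -> mx_integrable P (fun x => f x *: score x) ->
    (\int[P]_x (f x * score x ord0 j)%:E = - \int[P]_x (grad f x ord0 j)%:E)%E.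
  move=> fl ig ifs; apply: (stein_coord L0 dl sL pE fl); first exact: ig.
  by have := ifs ord0 j; under eq_fun do rewrite mxE.
split; [|split; [|split; [|split; [|split; [|split]]]]].
- split; first exact: rademacher_rV (score_lipschitz L0 sL).
  by move=> x dx; apply: (opnorm_jac_le sL) => //; exact: ltW.
- split.
    move=> x0; exists (p x0 * expR (enorm (score x0) ^+ 2 / (2 * L))),
      (x0 + L^-1 *: score x0); split.
    + by rewrite mulr_gt0// expR_gt0.
    + exact: tangent_gaussian_eq.
    + exact: grad_tangent_gaussian.
    + by move=> x; exact: tangent_gaussian_le.
  rewrite (_ : mkset _ = setT) ?closureT//.
  by apply/seteqP; split => // x _ /=; rewrite gt_eqF.
- by exists (expR (L * k%:R / 8)) => x; exact: (density_le L0 dl sL pE dp).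
- have [K K0 pK] := density_lipschitz L0 dl sL pE dp.
  (* [lipschitz] asks for the bound with every constant beyond some real one. *)
  exists K; split; first exact: num_real.
  by move=> M KM [x y] _ /=; rewrite (le_trans (pK x y))// ler_wpM2r// ltW.
- split; [|split].
  + move=> f fl ig ifs j; rewrite unlock.
    under eq_integral do rewrite mxE.
    exact: steinE (locally_lipschitz_dist_le fl) ig ifs.
  + move=> m f fl ig ifs i j; rewrite unlock.
    transitivity (- \int[P]_x (grad (fun y => f y ord0 i) x ord0 j)%:E)%E.
      rewrite -(steinE _ j (locE _ _ i fl) (ig i) (ifs i)).
      by apply: eq_integral => x _; rewrite !mxE big_ord1 !mxE.
    by congr (- _)%E; apply: eq_integral => x _; rewrite !mxE.
  + move=> f fl ig ifs; rewrite unlock.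
    have E1 x : (dotv (score x) (f x))%:E = (\sum_(i < k) (f x ord0 i * score x ord0 i)%:E)%E.
      by rewrite sumEFin; congr (_%:E); apply: eq_bigr => i _; rewrite mulrC.
    have E2 x : (divergence f x)%:E =
        (\sum_(i < k) (grad (fun y => f y ord0 i) x ord0 i)%:E)%E.
      by rewrite sumEFin; congr (_%:E); apply: eq_bigr => i _; rewrite !mxE.
    under eq_integral do rewrite E1.
    under [in RHS]eq_integral do rewrite E2.
    rewrite !integral_sum//.
    (* The sign passes through the sum of extended reals because every term is finite. *)
    - rewrite -fin_num_sumeN; last first.
        by move=> i _; exact: integrable_fin_num (ig i ord0 i).
      by apply: eq_bigr => i _; exact: steinE (locE _ _ i fl) (ig i) (ifs i).
    - by move=> i; exact: ig.
    - by move=> i; have := ifs i ord0 i; under eq_fun do rewrite mxE.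
- split.
    by move=> j; rewrite unlock; exact: (score_mean0 L0 dl sL pE dp).
  move=> i j; rewrite unlock.
  (* Both means vanish, so the covariance is the plain second moment. *)
  have E0 j' : ('E_P[fun x => score x ord0 j'] = 0)%E.
    by rewrite unlock; exact: (score_mean0 L0 dl sL pE dp).
  rewrite !E0 /= unlock -(score_covariance L0 dl sL pE dp).
  apply: eq_integral => x _; congr (_%:E).
  by rewrite -[LHS]/((score x ord0 i - 0) * (score x ord0 j - 0)) !subr0.
- split; [|split].
  + by move=> t; rewrite unlock; exact: (score_subgaussian L0 dl sL pE dp).
  + exact: (score_moments L0 dl sL pE dp).
  + exact: (hess_moments L0 sL dp).
Qed.
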